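(* Let $0\le t<1$. (i) For each $1<p<\infty$ the operator $C_t\in\mathcal{L}(ces_p)$ satisfies $$\|C_t\|_{ces_p\to ces_p}\le\min\{(1-t)^{-1},\,p/(p-1)\},$$ is compact and has spectra $\sigma_{pt}(C_t;ces_p)=\Lambda$ and $\sigma(C_t;ces_p)=\Lambda_0$. Moreover, $C_t$ is power bounded and uniformly mean ergodic in $ces_p$ but fails to be supercyclic. (ii) For $p=0$ the operator $C_t\in\mathcal{L}(ces_0)$ satisfies $\|C_t\|_{ces_0\to ces_0}=1$ and so it is power bounded. Moreover, $C_t$ is a compact operator in $ces_0$ with spectra $\sigma_{pt}(C_t;ces_0)=\Lambda$ and $\sigma(C_t;ces_0)=\Lambda_0$. In addition, $C_t$ is uniformly mean ergodic in $ces_0$ but not supercyclic. (iii) For $p=\infty$ the operator $C_t\in\mathcal{L}(ces_\infty)$ has norm $\|C_t\|_{ces_\infty\to ces_\infty}=1$ and so it is power bounded. Furthermore, $C_t$ is a compact operator in $ces_\infty$ with spectra $\sigma_{pt}(C_t;ces_\infty)=\Lambda$ and $\sigma(C_t;ces_\infty)=\Lambda_0$. In addition, $C_t$ is uniformly mean ergodic in $ces_\infty$ but fails to be supercyclic.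
   Context: Sequences are complex and indexed by $\mathbb{N}_0=\{0,1,2,\dots\}$; $\omega=\mathbb{C}^{\mathbb{N}_0}$. For $t\in[0,1]$ the generalized Cesàro operator is $C_tx=\big(\frac{t^nx_0+t^{n-1}x_1+\dots+x_n}{n+1}\big)_{n\in\mathbb{N}_0}$, with $t^0=1$ also for $t=0$. For $1<p<\infty$, $ces_p:=\{x\in\omega:\|x\|_{ces_p}:=\big(\sum_{n=0}^\infty(\frac1{n+1}\sum_{k=0}^n|x_k|)^p\big)^{1/p}<\infty\}$. $ces_\infty:=\{x\in\omega:\|x\|_{ces_\infty}:=\sup_n\frac1{n+1}\sum_{k=0}^n|x_k|<\infty\}$, and $ces_0$ is the closed subspace of those $x\in ces_\infty$ with $\frac1{n+1}\sum_{k=0}^n|x_k|\to0$ as $n\to\infty$, with the norm of $ces_\infty$. These are Banach spaces. $\Lambda:=\{\frac1{n+1}:n\in\mathbb{N}_0\}$ and $\Lambda_0:=\Lambda\cup\{0\}$. $\mathcal{L}(X)$ is the space of bounded linear operators on $X$; $\sigma(T;X)$ and $\sigma_{pt}(T;X)$ are the spectrum and point spectrum (set of eigenvalues) of $T$. With $T_{[n]}:=\frac1n\sum_{m=1}^nT^m$, $T$ is uniformly mean ergodic if $(T_{[n]})_{n\geq 1}$ converges in operator norm; power bounded if $\sup_{n\ge1}\|T^n\|<\infty$; supercyclic if there is $x\in X$ with $\{\lambda T^nx:\lambda\in\mathbb{C},n\in\mathbb{N}_0\}$ dense in $X$. *)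

(* Defs.v *)
From HB Require Import structures.
From mathcomp Require Import all_boot all_order all_algebra.
From mathcomp Require Import all_classical all_reals all_analysis.
From mathcomp Require Import complex.

Set Implicit Arguments.
Unset Strict Implicit.
Unset Printing Implicit Defensive.

Import Order.TTheory GRing.Theory Num.Theory.
Import numFieldNormedType.Exports.

Local Open Scope classical_set_scope.
Local Open Scope ring_scope.
Local Open Scope complex_scope.

(* the modulus on R[i], as an element of R; `|z| is cabs z seen in R[i] *)
Notation cabs := ComplexField.Normc.normc.

Section operators.
Variables (R : realType) (X : normedModType R[i]).
Implicit Types (T : X -> X) (x : X).

(* The norm of a [normedModType R[i]] takes values in R[i]; [rnorm] is the same
   norm, seen in R. *)
Definition rnorm x : R := complex.Re `|x|.

Definition bounded_operator : set (X -> X) :=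
  [set T | linear T /\ exists M : R, forall x, rnorm (T x) <= M * rnorm x].

(* [opnorm T] is +oo when T is unbounded on the unit ball. *)
Definition opnorm T : \bar R :=
  ereal_sup [set (rnorm (T x))%:E | x in [set x | rnorm x <= 1]].

Definition compact_operator T : Prop :=
  bounded_operator T /\ precompact (T @` [set x | rnorm x <= 1]).

Definition point_spectrum T : set R[i] :=
  [set l | exists2 x, x != 0 & T x = l *: x].

Definition resolvent_set T : set R[i] :=
  [set l | exists2 S, bounded_operator S &
    forall x, S (l *: x - T x) = x /\ l *: S x - T (S x) = x].

Definition spectrum T : set R[i] := ~` resolvent_set T.

Definition power_bounded T : Prop :=
  (ereal_sup [set opnorm (iter n T) | n in [set n | (1 <= n)%N]] < +oo)%E.

Definition ergodic_mean T (n : nat) : X -> X :=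
  fun x => n%:R^-1 *: \sum_(1 <= m < n.+1) iter m T x.

Definition uniformly_mean_ergodic T : Prop :=
  exists2 P, bounded_operator P &
    opnorm (fun x => ergodic_mean T n x - P x) @[n --> \oo] --> 0%E.

Definition supercyclic T : Prop :=
  exists x, dense [set l *: iter n T x | l in [set: R[i]] & n in [set: nat]].

End operators.

(* A subspace of the space of all sequences, with a norm on it; the values of
   [ss_norm] outside [ss_mem] are irrelevant. *)
Record seqspace (R : realType) := SeqSpace {
  ss_mem : set (nat -> R[i]) ;
  ss_norm : (nat -> R[i]) -> R ;
  ss_mem0 : ss_mem 0 ;
  ss_memL : forall a x y, ss_mem x -> ss_mem y -> ss_mem (a *: x + y) ;
  ss_normD : forall x y, ss_mem x -> ss_mem y ->
    ss_norm (x + y) <= ss_norm x + ss_norm y ;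
  ss_normZ : forall a x, ss_mem x -> ss_norm (a *: x) = cabs a * ss_norm x ;
  ss_norm_eq0 : forall x, ss_mem x -> ss_norm x = 0 -> x = 0
}.

Section seqspace_normed.
Variables (R : realType) (S : seqspace R).

Definition ss_pred : {pred nat -> R[i]} := mem (ss_mem S).

Record ss_type := SSType { ss_val :> nat -> R[i] ; ss_valP : ss_val \in ss_pred }.

HB.instance Definition _ := [isSub of ss_type for ss_val].
HB.instance Definition _ := [Choice of ss_type by <:].

Lemma ss_submod_closed : submod_closed ss_pred.
Proof.
split; first by rewrite inE; exact: ss_mem0.
by move=> a x y; rewrite !inE => xS yS; exact: ss_memL.
Qed.

HB.instance Definition _ := GRing.isSubmodClosed.Build _ _ ss_pred ss_submod_closed.
HB.instance Definition _ := [SubChoice_isSubLmodule of ss_type by <:].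

Definition ss_cnorm (x : ss_type) : R[i] := (ss_norm S (ss_val x))%:C.

Lemma ss_memP (x : ss_type) : ss_mem S (ss_val x).
Proof. by have := ss_valP x; rewrite inE. Qed.

Let cnormD (x y : ss_type) : ss_cnorm (x + y) <= ss_cnorm x + ss_cnorm y.
Proof.
rewrite /ss_cnorm -rmorphD lecR.
exact: ss_normD (ss_memP x) (ss_memP y).
Qed.

Let cnormZ (a : R[i]) (x : ss_type) : ss_cnorm (a *: x) = `|a| * ss_cnorm x.
Proof.
rewrite /ss_cnorm [ss_norm _ _](ss_normZ a (ss_memP x)).
by rewrite rmorphM.
Qed.

Let cnorm_eq0 (x : ss_type) : ss_cnorm x = 0 -> x = 0.
Proof.
by move=> [x0]; apply: val_inj; exact: ss_norm_eq0 (ss_memP x) x0.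
Qed.

HB.instance Definition _ :=
  Lmodule_isNormed.Build R[i] ss_type cnormD cnormZ cnorm_eq0.

Lemma rnormE (x : ss_type) : rnorm x = ss_norm S x.
Proof. by []. Qed.

End seqspace_normed.

Section cesaro_spaces.
Variable R : realType.
Implicit Types (x y : nat -> R[i]) (p : R).

Definition cesaro_abs x (n : nat) : R :=
  n.+1%:R^-1 * \sum_(0 <= k < n.+1) cabs (x k).

Definition ces_pnorm p x : \bar R :=
  ((\sum_(0 <= n <oo) (cesaro_abs x n `^ p)%:E) `^ p^-1)%E.

Definition ces_inftynorm x : \bar R :=
  ereal_sup [set (cesaro_abs x n)%:E | n in [set: nat]].

Lemma cesaro_abs_ge0 x n : 0 <= cesaro_abs x n.
Proof.
rewrite mulr_ge0// sumr_ge0// => k _.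
by rewrite -ler0c -[(cabs _)%:C]/`|x k| normr_ge0.
Qed.

Lemma cesaro_abs0 n : cesaro_abs 0 n = 0.
Proof.
by rewrite /cesaro_abs big1 ?mulr0// => k _; exact: ComplexField.Normc.normc0.
Qed.

Lemma cesaro_absD x y n :
  cesaro_abs (x + y) n <= cesaro_abs x n + cesaro_abs y n.
Proof.
rewrite /cesaro_abs -mulrDr ler_wpM2l// -big_split/=.
by apply: ler_sum => k _; exact: le_normcD.
Qed.

Lemma cesaro_absZ (a : R[i]) x n : cesaro_abs (a *: x) n = cabs a * cesaro_abs x n.
Proof.
rewrite /cesaro_abs mulrCA; congr (_ * _); rewrite mulr_sumr.
by apply: eq_bigr => k _; exact: ComplexField.Normc.normcM.
Qed.

Lemma cabs_ge0 (a : R[i]) : 0 <= cabs a.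
Proof. by rewrite -ler0c -[(cabs _)%:C]/`|a| normr_ge0. Qed.

Lemma cesaro_abs_eq0 x : (forall n, cesaro_abs x n = 0) -> x = 0.
Proof.
move=> x0; apply/funext => k; apply: ComplexField.Normc.eq0_normc.
have /eqP := x0 k; rewrite mulf_eq0 invr_eq0 pnatr_eq0/= big_nat_recr//=.
rewrite paddr_eq0 ?cabs_ge0 ?sumr_ge0// => [/andP[_ /eqP]//|i _].
exact: cabs_ge0.
Qed.

Section pnorm.
Variables (p : R) (p1 : 1 < p).
Let p0 : 0 < p. Proof. exact: lt_trans p1. Qed.

Lemma ces_pnormE x :
  ces_pnorm p x = 'N[counting]_p%:E [EFin \o cesaro_abs x]%E.
Proof.
rewrite Lnorm_counting//; congr (_ `^ _)%E; apply: eq_eseriesr => n _ /=.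
by rewrite ger0_norm// cesaro_abs_ge0.
Qed.

Lemma ces_pnorm_ge0 x : (0 <= ces_pnorm p x)%E.
Proof. exact: poweR_ge0. Qed.

Lemma ces_pnorm0 : ces_pnorm p 0 = 0%E.
Proof.
rewrite /ces_pnorm eseries0 ?poweR0r// ?invr_eq0 ?gt_eqF// => n _ _.
by rewrite cesaro_abs0 powR0// gt_eqF.
Qed.

Lemma ces_pnormD x y :
  (ces_pnorm p (x + y)%R <= ces_pnorm p x + ces_pnorm p y)%E.
Proof.
rewrite !ces_pnormE; apply: le_trans (minkowski_EFin _ _ _ _) => //; last first.
  exact: ltW.
rewrite -!ces_pnormE; rewrite Lnorm_counting// /ces_pnorm.
have pV0 : 0 <= p^-1 by rewrite invr_ge0 ltW.
apply: gt0_ler_poweR => //.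
- by rewrite in_itv/= leey nneseries_ge0// => n _ _; rewrite lee_fin powR_ge0.
- by rewrite in_itv/= leey nneseries_ge0// => n _ _; exact: poweR_ge0.
apply: lee_nneseries => n _ *; first by rewrite lee_fin powR_ge0.
rewrite /= lee_fin ge0_ler_powR ?nnegrE ?cesaro_abs_ge0 ?(ltW p0)//.
exact: le_trans (cesaro_absD _ _ _) (ler_norm _).
Qed.

Lemma ces_pnormZ (a : R[i]) x :
  ces_pnorm p (a *: x) = ((cabs a)%:E * ces_pnorm p x)%E.
Proof.
rewrite /ces_pnorm.
under eq_eseriesr do rewrite cesaro_absZ powRM ?cabs_ge0 ?cesaro_abs_ge0// EFinM.
rewrite nneseriesZl// ?lee_fin ?powR_ge0//; last first.
  by move=> n _; rewrite lee_fin powR_ge0.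
rewrite poweRM ?lee_fin ?powR_ge0// ?nneseries_ge0//; last first.
  by move=> n _ _; rewrite lee_fin powR_ge0.
by rewrite poweR_EFin -powRrM mulfV ?gt_eqF// powRr1// cabs_ge0.
Qed.

Lemma ces_pnorm_eq0 x : ces_pnorm p x = 0%E -> x = 0.
Proof.
have t0 k : (0 <= (cesaro_abs x k `^ p)%:E)%E by rewrite lee_fin powR_ge0.
move=> /poweR_eq0_eq0 s0; apply: cesaro_abs_eq0 => n.
have /(_ n.+1) := @nneseries_lim_ge _ _ xpredT 0 _ (fun k _ _ => t0 k).
rewrite s0; last exact: nneseries_ge0.
rewrite big_nat_recr//= => le0.
have : ((cesaro_abs x n `^ p)%:E <= 0)%E.
  by apply: le_trans le0; rewrite leeDr// sume_ge0.
rewrite lee_fin => c0; apply/eqP; rewrite -[_ == 0]andbT.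
rewrite -(_ : p != 0); last by rewrite gt_eqF.
by rewrite -powR_eq0 eq_le c0 powR_ge0.
Qed.

Definition ces_pmem : set (nat -> R[i]) := [set x | (ces_pnorm p x < +oo)%E].

Lemma ces_pmem_fin x : ces_pmem x -> ces_pnorm p x \is a fin_num.
Proof. by move=> xfin; rewrite ge0_fin_numE ?ces_pnorm_ge0. Qed.

Lemma ces_pmem0 : ces_pmem 0.
Proof. by rewrite /ces_pmem/= ces_pnorm0. Qed.

Lemma ces_pmemL (a : R[i]) x y : ces_pmem x -> ces_pmem y -> ces_pmem (a *: x + y).
Proof.
move=> xfin yfin; apply: le_lt_trans (ces_pnormD _ _) _.
rewrite ces_pnormZ lte_add_pinfty// lte_mul_pinfty// ?lee_fin ?cabs_ge0//.
Qed.

Lemma ces_pfineD x y : ces_pmem x -> ces_pmem y ->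
  fine (ces_pnorm p (x + y)) <= fine (ces_pnorm p x) + fine (ces_pnorm p y).
Proof.
move=> xfin yfin; have xyfin := ces_pmemL 1 xfin yfin.
rewrite scale1r in xyfin.
rewrite -fineD ?ces_pmem_fin// fine_le ?ces_pnormD ?fin_numD ?ces_pmem_fin//.
Qed.

Lemma ces_pfineZ (a : R[i]) x : ces_pmem x ->
  fine (ces_pnorm p (a *: x)) = cabs a * fine (ces_pnorm p x).
Proof. by move=> xfin; rewrite ces_pnormZ fineM ?ces_pmem_fin. Qed.

Lemma ces_pfine_eq0 x : ces_pmem x -> fine (ces_pnorm p x) = 0 -> x = 0.
Proof.
by move=> xfin x0; apply: ces_pnorm_eq0; rewrite -(fineK (ces_pmem_fin xfin)) x0.
Qed.

Definition ces_p_space : seqspace R :=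
  @SeqSpace R ces_pmem (fun x => fine (ces_pnorm p x)) ces_pmem0 ces_pmemL
    ces_pfineD ces_pfineZ ces_pfine_eq0.

End pnorm.

Definition ces_inftymem : set (nat -> R[i]) :=
  [set x | (ces_inftynorm x < +oo)%E].

Definition ces_0mem : set (nat -> R[i]) :=
  [set x | ces_inftymem x /\ cesaro_abs x n @[n --> \oo] --> (0 : R)].

Lemma ces_inftynorm_ge x n : ((cesaro_abs x n)%:E <= ces_inftynorm x)%E.
Proof. by apply: ereal_sup_ubound; exists n. Qed.

Lemma ces_inftynorm_ge0 x : (0 <= ces_inftynorm x)%E.
Proof.
by apply: le_trans (ces_inftynorm_ge x 0); rewrite lee_fin cesaro_abs_ge0.
Qed.

Lemma ces_inftymem_fin x : ces_inftymem x -> ces_inftynorm x \is a fin_num.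
Proof. by move=> xfin; rewrite ge0_fin_numE ?ces_inftynorm_ge0. Qed.

Lemma ces_inftynorm0 : ces_inftynorm 0 = 0%E.
Proof.
apply/eqP; rewrite eq_le ces_inftynorm_ge0 andbT; apply: ge_ereal_sup.
by move=> _ [n _ <-]; rewrite cesaro_abs0.
Qed.

Lemma ces_inftynormD x y :
  (ces_inftynorm (x + y)%R <= ces_inftynorm x + ces_inftynorm y)%E.
Proof.
apply: ge_ereal_sup => _ [n _ <-].
apply: (@le_trans _ _ ((cesaro_abs x n)%:E + (cesaro_abs y n)%:E)%E).
  by rewrite -EFinD lee_fin cesaro_absD.
by apply: leeD; exact: ces_inftynorm_ge.
Qed.

Lemma ces_inftynormZ (a : R[i]) x :
  ces_inftynorm (a *: x) = ((cabs a)%:E * ces_inftynorm x)%E.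
Proof.
rewrite /ces_inftynorm -ereal_supZl ?cabs_ge0//; last first.
  by apply/set0P; exists (cesaro_abs x 0)%:E; exists 0.
rewrite image_comp; congr ereal_sup; apply: eq_imagel => n _ /=.
by rewrite cesaro_absZ EFinM.
Qed.

Lemma ces_inftynorm_eq0 x : ces_inftynorm x = 0%E -> x = 0.
Proof.
move=> x0; apply: cesaro_abs_eq0 => n; apply/eqP.
by rewrite eq_le cesaro_abs_ge0 andbT -lee_fin (le_trans (ces_inftynorm_ge x n)) ?x0.
Qed.

Lemma ces_inftymem0 : ces_inftymem 0.
Proof. by rewrite /ces_inftymem/= ces_inftynorm0. Qed.

Lemma ces_inftymemL (a : R[i]) x y :
  ces_inftymem x -> ces_inftymem y -> ces_inftymem (a *: x + y).
Proof.
move=> xfin yfin; apply: le_lt_trans (ces_inftynormD _ _) _.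
rewrite ces_inftynormZ lte_add_pinfty// lte_mul_pinfty// ?lee_fin ?cabs_ge0//.
Qed.

Lemma ces_inftyfineD x y : ces_inftymem x -> ces_inftymem y ->
  fine (ces_inftynorm (x + y)) <= fine (ces_inftynorm x) + fine (ces_inftynorm y).
Proof.
move=> xfin yfin; have xyfin := ces_inftymemL 1 xfin yfin.
rewrite scale1r in xyfin.
rewrite -fineD ?ces_inftymem_fin//.
by rewrite fine_le ?ces_inftynormD ?fin_numD ?ces_inftymem_fin.
Qed.

Lemma ces_inftyfineZ (a : R[i]) x : ces_inftymem x ->
  fine (ces_inftynorm (a *: x)) = cabs a * fine (ces_inftynorm x).
Proof. by move=> xfin; rewrite ces_inftynormZ fineM ?ces_inftymem_fin. Qed.

Lemma ces_inftyfine_eq0 x :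
  ces_inftymem x -> fine (ces_inftynorm x) = 0 -> x = 0.
Proof.
move=> xfin x0; apply: ces_inftynorm_eq0.
by rewrite -(fineK (ces_inftymem_fin xfin)) x0.
Qed.

Lemma ces_0mem0 : ces_0mem 0.
Proof.
split; first exact: ces_inftymem0.
by rewrite (_ : cesaro_abs 0 = cst 0); [exact: cvg_cst|apply/funext => n; exact: cesaro_abs0].
Qed.

Lemma ces_0memL (a : R[i]) x y : ces_0mem x -> ces_0mem y -> ces_0mem (a *: x + y).
Proof.
move=> [xfin x0] [yfin y0]; split; first exact: ces_inftymemL.
apply: (@squeeze_cvgr _ _ _ _ (cst 0)
  (fun n => cabs a * cesaro_abs x n + cesaro_abs y n)).
- apply: nearW => n; rewrite cesaro_abs_ge0/= -cesaro_absZ; exact: cesaro_absD.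
- exact: cvg_cst.
- rewrite -[X in _ --> X]addr0 -[X in _ --> X + _](mulr0 (cabs a)).
  by apply: cvgD => //; exact: cvgMl_tmp.
Qed.

Definition ces_infty_space : seqspace R :=
  @SeqSpace R ces_inftymem (fun x => fine (ces_inftynorm x))
    ces_inftymem0 ces_inftymemL ces_inftyfineD ces_inftyfineZ
    ces_inftyfine_eq0.

Definition ces_0_space : seqspace R :=
  @SeqSpace R ces_0mem (fun x => fine (ces_inftynorm x)) ces_0mem0 ces_0memL
    (fun x y xS yS => ces_inftyfineD xS.1 yS.1)
    (fun a x xS => ces_inftyfineZ a xS.1)
    (fun x xS => ces_inftyfine_eq0 xS.1).

End cesaro_spaces.

Definition ces_p (R : realType) (p : R) (p1 : 1 < p) := ss_type (ces_p_space p1).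
Definition ces_0 (R : realType) := ss_type (ces_0_space R).
Definition ces_infty (R : realType) := ss_type (ces_infty_space R).

(* [_ ^+ 0] is 1, also at t = 0, so that gen_cesaro 0 is diagonal. *)
Definition gen_cesaro (R : realType) (t : R) (x : nat -> R[i]) : nat -> R[i] :=
  fun n => (\sum_(0 <= k < n.+1) t%:C ^+ (n - k) * x k) / n.+1%:R.

Definition acts_as_gen_cesaro (R : realType) (S : seqspace R) (t : R)
    (T : ss_type S -> ss_type S) : Prop :=
  forall x, T x = gen_cesaro t x :> (nat -> R[i]).

Definition Lambda (R : realType) : set R[i] :=
  [set n.+1%:R^-1 | n in [set: nat]].
Arguments Lambda R : clear implicits.

Definition Lambda0 (R : realType) : set R[i] :=
  Lambda R `|` [set 0].
Arguments Lambda0 R : clear implicits.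

(* Main.v *)
(** Everything is reduced to partial sums [asum x n = |x_0| + ... + |x_(n-1)|]:
    an inequality [asum (F x) n <= M * asum x n] for all [n] makes [F] bounded
    on each of the three spaces at once.

    On partial sums, [C_t] is bounded by the convolution with [(t^n)], and its
    rows of index at least [N] contribute at most [1/((N+1)(1-t))]; this gives
    compactness and [0] in the spectrum.  The strictly lower triangular part
    of [C_t] becomes arbitrarily small for a weighted partial sum with weights
    bounded above and below, so [C_t] behaves like its diagonal [1/(n+1)]:
    triangular systems can be solved boundedly (resolvent, eigenvectors), and
    the powers of [C_t] converge geometrically to the projection
    [x |-> x_0 (t^n)_n] (power boundedness, mean ergodicity).  The coordinate
    functionals [x_0] and [x_1 - t x_0] are eigenvectors of the adjoint for two
    distinct eigenvalues, which excludes supercyclicity. *)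
Require Import Defs.
From mathcomp Require Import all_boot all_order all_algebra.
From mathcomp Require Import all_classical all_reals all_analysis.
From mathcomp Require Import complex ring lra.

Set Implicit Arguments.
Unset Strict Implicit.
Unset Printing Implicit Defensive.

Import Order.TTheory GRing.Theory Num.Theory.
Import numFieldNormedType.Exports.

Local Open Scope classical_set_scope.
Local Open Scope ring_scope.

(** * Sequences and partial sums *)

Section modulus.
Variable R : realType.
Implicit Types z w : R[i].

Lemma cabsD z w : cabs (z + w) <= cabs z + cabs w.
Proof. exact: le_normcD. Qed.

Lemma cabsM z w : cabs (z * w) = cabs z * cabs w.
Proof. exact: ComplexField.Normc.normcM. Qed.

Lemma cabsV z : cabs z^-1 = (cabs z)^-1.
Proof. exact: ComplexField.Normc.normcV. Qed.

Lemma cabs0 : cabs (0 : R[i]) = 0.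
Proof. exact: ComplexField.Normc.normc0. Qed.

Lemma cabs1 : cabs (1 : R[i]) = 1.
Proof. exact: ComplexField.Normc.normc1. Qed.

Lemma cabsN z : cabs (- z) = cabs z.
Proof. exact: normcN. Qed.

Lemma cabs_eq0 z : (cabs z == 0) = (z == 0).
Proof.
by apply/eqP/eqP => [/ComplexField.Normc.eq0_normc //|->]; rewrite cabs0.
Qed.

Lemma cabs_gt0 z : (0 < cabs z) = (z != 0).
Proof. by rewrite lt0r cabs_eq0 cabs_ge0 andbT. Qed.

Lemma cabs_real (a : R) : 0 <= a -> cabs a%:C%C = a.
Proof.
by move=> a0; apply: complexI; rewrite -[LHS]/`|a%:C%C| ger0_norm ?ler0c.
Qed.

Lemma realC_gt0 (a : R) : 0 < a -> 0 < a%:C%C.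
Proof. by move=> a0; rewrite -[ltLHS]/((0 : R)%:C%C) ltcR. Qed.

Lemma real_complex_nat n : (n%:R : R)%:C%C = n%:R :> R[i].
Proof. exact: (rmorph_nat (@real_complex R)). Qed.

Lemma cabs_nat n : cabs (n%:R : R[i]) = n%:R.
Proof. by rewrite -real_complex_nat cabs_real. Qed.

Lemma cabsX z n : cabs (z ^+ n) = cabs z ^+ n.
Proof.
by elim: n => [|n IH]; rewrite ?expr0 ?cabs1// !exprS cabsM IH.
Qed.

Lemma cabs_sum I (r : seq I) (P : pred I) (F : I -> R[i]) :
  cabs (\sum_(i <- r | P i) F i) <= \sum_(i <- r | P i) cabs (F i).
Proof.
elim/big_ind2 : _ => [|x1 x2 y1 y2 h1 h2|//]; first by rewrite cabs0.
exact: le_trans (cabsD _ _) (lerD h1 h2).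
Qed.

Lemma le_cabs_ReIm (a b : R) : cabs (a +i* b)%C <= `|a| + `|b|.
Proof.
rewrite -(ler_pXn2r (n := 2))// ?nnegrE ?cabs_ge0 ?addr_ge0//.
rewrite sqr_sqrtr ?addr_ge0 ?sqr_ge0// sqrrD !real_normK ?num_real//.
by rewrite addrAC lerDl mulrn_wge0 ?mulr_ge0.
Qed.

Lemma Re_le_cabs z : `|complex.Re z| <= cabs z.
Proof.
case: z => a b /=; rewrite -(ler_pXn2r (n := 2))// ?nnegrE ?sqrtr_ge0//.
by rewrite sqr_sqrtr ?addr_ge0 ?sqr_ge0// real_normK ?num_real// lerDl sqr_ge0.
Qed.

Lemma Im_le_cabs z : `|complex.Im z| <= cabs z.
Proof.
case: z => a b /=; rewrite -(ler_pXn2r (n := 2))// ?nnegrE ?sqrtr_ge0//.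
by rewrite sqr_sqrtr ?addr_ge0 ?sqr_ge0// real_normK ?num_real// lerDr sqr_ge0.
Qed.

End modulus.

(** * Weighted partial sums, sections and tails of sequences *)

Section sequences.
Variable R : realType.
Implicit Types (x y : nat -> R[i]) (w : nat -> R).

Definition wsum w x (n : nat) : R := \sum_(0 <= k < n) w k * cabs (x k).

Definition asum x (n : nat) : R := \sum_(0 <= k < n) cabs (x k).

Definition unit_seq (m : nat) : nat -> R[i] := fun k => (k == m)%:R.

Definition sec (N : nat) x : nat -> R[i] := fun k => if (k < N)%N then x k else 0.

Definition tail (N : nat) x : nat -> R[i] := fun k => if (k < N)%N then 0 else x k.

Lemma asum_ge0 x n : 0 <= asum x n.
Proof. by apply: sumr_ge0 => k _; exact: cabs_ge0. Qed.

Lemma asum_homo x : {homo asum x : m n / (m <= n)%N >-> m <= n}.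
Proof.
move=> m n mn; rewrite /asum (big_cat_nat _ mn)//= lerDl sumr_ge0// => k _.
exact: cabs_ge0.
Qed.

Lemma cabs_le_asum x k n : (k < n)%N -> cabs (x k) <= asum x n.
Proof.
move=> kn; apply: le_trans (asum_homo x kn).
by rewrite /asum big_nat_recr//= lerDr asum_ge0.
Qed.

Lemma asumD x y n : asum (x + y) n <= asum x n + asum y n.
Proof. by rewrite /asum -big_split/=; apply: ler_sum => k _; exact: cabsD. Qed.

Lemma asumZ (a : R[i]) x n : asum (a *: x) n = cabs a * asum x n.
Proof. by rewrite /asum mulr_sumr; apply: eq_bigr => k _; rewrite -cabsM. Qed.

Lemma asum_sec N x n : asum (sec N x) n = asum x (minn n N).
Proof.
elim: n => [|n IH]; first by rewrite min0n /asum !big_geq.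
rewrite {1}/asum big_nat_recr//= -/(asum _ n) IH /sec.
case: (ltnP n N) => nN.
  by rewrite (minn_idPl nN) [in RHS]/asum big_nat_recr.
by rewrite (minn_idPr (leqW nN)) cabs0 addr0.
Qed.

Lemma sec_tail N x : x = sec N x + tail N x.
Proof.
by apply/funext => k; rewrite !fctE /sec /tail; case: ifP; rewrite ?addr0 ?add0r.
Qed.

Lemma cesaro_abs_leM x y M :
  (forall n, asum y n <= M * asum x n) ->
  forall n, cesaro_abs y n <= M * cesaro_abs x n.
Proof. by move=> yx n; rewrite mulrCA ler_wpM2l ?yx. Qed.

Lemma asum_unit m n : asum (unit_seq m) n = (m < n)%:R.
Proof.
elim: n => [|n IH]; first by rewrite /asum big_geq.
rewrite /asum big_nat_recr//= -/(asum _ n) IH /unit_seq cabs_nat -natrD ltnS.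
by case: ltngtP.
Qed.

(** Every partial sum of [unit_seq 0] over at least one term is 1. Through this bound finite
    sections belong to any solid space containing [unit_seq 0]. *)
Lemma asum_sec_le N x n : asum (sec N x) n <= asum x N * asum (unit_seq 0) n.
Proof.
case: n => [|n]; first by rewrite [leLHS]big_geq// mulr_ge0 ?asum_ge0.
by rewrite asum_unit mulr1 asum_sec asum_homo// geq_minr.
Qed.

Lemma cesaro_abs_unit0 n : cesaro_abs (unit_seq 0) n = n.+1%:R^-1.
Proof. by rewrite /cesaro_abs -/(asum _ _) asum_unit mulr1. Qed.

End sequences.

Arguments unit_seq R m : clear implicits.

(** * Partial sum estimates for the generalized Cesàro matrix *)

Section gen_cesaro_estimates.
Variables (R : realType) (t : R) (t_ge0 : 0 <= t) (t_lt1 : t < 1).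
Implicit Types (x y : nat -> R[i]) (b w : nat -> R).
Local Notation C := (gen_cesaro t).

Lemma subt_gt0 : 0 < 1 - t. Proof. by rewrite subr_gt0. Qed.

(** Exchanging the sums, [b k] receives the truncated geometric sum $(1-t^{n-k})/(1-t)$; the second
    sum restores the missing $t^{n-k}$. The exact identity is what makes the induction work. *)
Lemma geom_convolution b n :
  (1 - t) * (\sum_(0 <= m < n) \sum_(0 <= k < m.+1) t ^+ (m - k) * b k) +
    \sum_(0 <= k < n) t ^+ (n - k) * b k = \sum_(0 <= k < n) b k.
Proof.
elim: n => [|n IH]; first by rewrite !big_geq// mulr0 addr0.
rewrite big_nat_recr//= mulrDr.
have -> : \sum_(0 <= k < n.+1) t ^+ (n.+1 - k) * b k =
    t * \sum_(0 <= k < n.+1) t ^+ (n - k) * b k.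
  rewrite mulr_sumr; apply: eq_big_nat => k /andP[_ kn].
  by rewrite subSn// exprS mulrA.
rewrite [RHS]big_nat_recr//= -IH [in LHS]big_nat_recr//= subnn expr0 mul1r.
ring.
Qed.

Lemma geom_convolution_le b n : (forall k, 0 <= b k) ->
  (1 - t) * (\sum_(0 <= m < n) \sum_(0 <= k < m.+1) t ^+ (m - k) * b k) <=
  \sum_(0 <= k < n) b k.
Proof.
move=> b0; rewrite -(geom_convolution b n) lerDl sumr_ge0// => k _.
by rewrite mulr_ge0 ?exprn_ge0.
Qed.

(* Schur-type test: [y] is dominated by a geometric convolution of [w |x|]. *)
Lemma wsum_convolution w x y q n :
  0 <= q -> (forall k, 0 <= w k) ->
  (forall m, w m * cabs (y m) <=
     \sum_(0 <= k < m.+1) t ^+ (m - k) * (q * (w k * cabs (x k)))) ->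
  wsum w y n <= q / (1 - t) * wsum w x n.
Proof.
move=> q0 w0 ywx; rewrite mulrAC ler_pdivlMr ?subt_gt0// mulrC.
apply: (@le_trans _ _ ((1 - t) * (\sum_(0 <= m < n) \sum_(0 <= k < m.+1)
    t ^+ (m - k) * (q * (w k * cabs (x k)))))).
  by rewrite ler_pM2l ?subt_gt0//; apply: ler_sum => m _; exact: ywx.
rewrite [leRHS]mulr_sumr.
apply: (@geom_convolution_le (fun k => q * (w k * cabs (x k)))) => k.
by rewrite !mulr_ge0 ?cabs_ge0.
Qed.

Lemma asumE x n : asum x n = wsum (fun=> 1) x n.
Proof. by apply: eq_bigr => k _; rewrite mul1r. Qed.

Lemma cabs_tX k : cabs (t%:C%C ^+ k) = t ^+ k.
Proof. by rewrite cabsX cabs_real. Qed.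

Lemma cabs_gen_cesaro x m :
  cabs (C x m) <= \sum_(0 <= k < m.+1) t ^+ (m - k) * (m.+1%:R^-1 * cabs (x k)).
Proof.
rewrite /gen_cesaro cabsM cabsV cabs_nat mulrC.
apply: (@le_trans _ _ (m.+1%:R^-1 * \sum_(0 <= k < m.+1) t ^+ (m - k) * cabs (x k))).
  rewrite ler_wpM2l//; apply: le_trans (cabs_sum _ _ _) _.
  by apply: ler_sum => k _; rewrite cabsM cabs_tX.
by rewrite mulr_sumr; apply: ler_sum => k _; rewrite mulrCA.
Qed.

(** Since $t\le 1$, the classical Cesàro means dominate. This yields the bound $p/(p-1)$ through
    Hardy's inequality, and norm 1 for the supremum norm. *)
Lemma cabs_gen_cesaro_le x m : cabs (C x m) <= cesaro_abs x m.
Proof.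
apply: le_trans (cabs_gen_cesaro _ _) _.
rewrite /cesaro_abs mulr_sumr; apply: ler_sum => k _.
by rewrite ler_piMl ?mulr_ge0 ?cabs_ge0// exprn_ile1// ltW.
Qed.

Lemma invn_le N m : (N <= m)%N -> (m.+1%:R : R)^-1 <= N.+1%:R^-1.
Proof. by move=> Nm; rewrite lef_pV2 ?posrE// ler_nat ltnS. Qed.

(** The rows from [N] on carry a factor at most $1/(N+1)$; what remains is convolution with a
    geometric sequence of sum $1/(1-t)$. *)
Lemma asum_gen_cesaro_tail N x n :
  asum (tail N (C x)) n <= N.+1%:R^-1 / (1 - t) * asum x n.
Proof.
rewrite !asumE; apply: wsum_convolution => // m.
rewrite mul1r /tail; case: ltnP => [_|Nm].
  rewrite cabs0 sumr_ge0// => k _.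
  by rewrite !mulr_ge0 ?exprn_ge0 ?cabs_ge0.
apply: le_trans (cabs_gen_cesaro _ _) _; apply: ler_sum => k _.
by rewrite mul1r ler_wpM2l ?exprn_ge0// ler_wpM2r ?cabs_ge0 ?invn_le.
Qed.

Lemma asum_gen_cesaro x n : asum (C x) n <= (1 - t)^-1 * asum x n.
Proof. by have := asum_gen_cesaro_tail 0 x n; rewrite invr1 mul1r. Qed.

Lemma gen_cesaroL a x y : C (a *: x + y) = a *: C x + C y.
Proof.
apply/funext => n; rewrite !fctE /gen_cesaro.
under eq_bigr do rewrite mulrDr mulrCA.
by rewrite big_split/= mulrDl -mulr_sumr -mulrA.
Qed.

Definition strict_cesaro x : nat -> R[i] :=
  fun n => (\sum_(0 <= k < n) t%:C%C ^+ (n - k) * x k) / n.+1%:R.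

Lemma gen_cesaroE x n : C x n = strict_cesaro x n + n.+1%:R^-1 * x n.
Proof.
rewrite /gen_cesaro big_nat_recr//= subnn expr0 mul1r mulrDl; congr (_ + _).
exact: mulrC.
Qed.

Lemma cabs_strict_cesaro x m : cabs (strict_cesaro x m) <=
  \sum_(0 <= k < m) t ^+ (m - k) * (m.+1%:R^-1 * cabs (x k)).
Proof.
rewrite /strict_cesaro cabsM cabsV cabs_nat mulrC.
apply: (@le_trans _ _ (m.+1%:R^-1 * \sum_(0 <= k < m) t ^+ (m - k) * cabs (x k))).
  rewrite ler_wpM2l//; apply: le_trans (cabs_sum _ _ _) _.
  by apply: ler_sum => k _; rewrite cabsM cabs_tX.
by rewrite mulr_sumr; apply: ler_sum => k _; rewrite mulrCA.
Qed.

(** The two-sided bound makes [wsum w] and [asum] comparable with constants independent of the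
    number of terms. *)
Definition good_weight (W : R) w := forall k, 1 <= w k <= W.

Lemma asum_le_wsum W w x n : good_weight W w -> asum x n <= wsum w x n.
Proof.
move=> wW; apply: ler_sum => k _; have /andP[w1 _] := wW k.
by rewrite ler_peMl ?cabs_ge0.
Qed.

Lemma wsum_le_asum W w x n : good_weight W w -> wsum w x n <= W * asum x n.
Proof.
move=> wW; rewrite mulr_sumr; apply: ler_sum => k _; have /andP[_ w1] := wW k.
by rewrite ler_wpM2r ?cabs_ge0.
Qed.

(** Below [K] the weight drops at each step by a factor [A] that is at least $1/e$; from [K] on it
    is constantly 1, by truncated subtraction, and $1/(m+1)$ is itself below [e]. *)
Lemma weight_exists (e : R) : 0 < e ->
  exists W w, good_weight W w /\
    forall k m, (k < m)%N -> w m / m.+1%:R <= e * w k.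
Proof.
move=> e0; pose A := Num.max 1 e^-1; pose K := Num.truncn e^-1.
have A1 : 1 <= A by rewrite le_max lexx.
exists (A ^+ K), (fun k => A ^+ (K - k)); split.
  by move=> k; rewrite exprn_ege1//= ler_weXn2l// leq_subr.
move=> k m km; case: (ltnP k K) => kK; last first.
  have -> : (K - m)%N = 0%N by apply/eqP; rewrite subn_eq0 (leq_trans kK)// ltnW.
  have -> : (K - k)%N = 0%N by apply/eqP; rewrite subn_eq0.
  rewrite !expr0 mul1r mulr1 -[leRHS]invrK lef_pV2 ?posrE ?invr_gt0//.
  apply/ltW; apply: (lt_le_trans (truncnS_gt _)).
  by rewrite -/K ler_nat ltnS (leq_trans kK)// ltnW.
apply: (@le_trans _ _ (A ^+ (K - m))).
  by rewrite ler_pdivrMr// ler_peMr ?exprn_ge0 ?(le_trans ler01)// ler1n.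
apply: (@le_trans _ _ (A ^+ (K - k).-1)).
  by rewrite ler_weXn2l// -subnS leq_sub2l.
have -> : (K - k)%N = (K - k).-1.+1 by rewrite prednK// subn_gt0.
rewrite exprS mulrA ler_peMl ?exprn_ge0 ?(le_trans ler01)//.
by rewrite -ler_pdivrMl// mulr1 le_max lexx orbT.
Qed.

(* The strictly lower triangular part of [C] is quasi-nilpotent: it is made
   small by a weight decreasing geometrically up to some index and then
   constant. *)
Lemma strict_cesaro_small (e : R) : 0 < e ->
  exists W w, good_weight W w /\
    forall x n, wsum w (strict_cesaro x) n <= e * wsum w x n.
Proof.
(* The factor $1-t$ compensates the loss of $1/(1-t)$ in [wsum_convolution]. *)
move=> e0; have [|W [w [wW wk]]] := @weight_exists (e * (1 - t)).
  by rewrite mulr_gt0 ?subt_gt0.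
exists W, w; split=> // x n.
have w0 k : 0 <= w k by have /andP[w1 _] := wW k; rewrite (le_trans ler01).
have t1 : 1 - t != 0 by rewrite gt_eqF// subt_gt0.
rewrite -[e in leRHS](mulfK t1).
apply: wsum_convolution => // [|m]; first by rewrite mulr_ge0// ltW// subt_gt0.
apply: (@le_trans _ _ (\sum_(0 <= k < m) t ^+ (m - k) *
    (e * (1 - t) * (w k * cabs (x k))))); last first.
  rewrite [leRHS]big_nat_recr//= lerDl.
  by rewrite !mulr_ge0 ?exprn_ge0 ?cabs_ge0 ?(ltW e0) ?(ltW subt_gt0).
apply: le_trans (ler_wpM2l (w0 m) (cabs_strict_cesaro _ _)) _.
rewrite mulr_sumr !big_nat; apply: ler_sum => k /andP[_ km].
rewrite mulrCA ler_wpM2l ?exprn_ge0// !mulrA ler_wpM2r ?cabs_ge0//.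
exact: wk.
Qed.

End gen_cesaro_estimates.

(** * Triangular systems and powers *)

Section triangular_systems.
Variables (R : realType) (t : R).
Implicit Types (x y d : nat -> R[i]).
Local Notation C := (gen_cesaro t).
Local Notation L := (strict_cesaro t).

(** Forward substitution for $d_n x_n = y_n + (Lx)_n$. The first [n] entries are kept as a table,
    with 0 beyond, so that the recursion is structural although row [n] uses all earlier entries. *)
Fixpoint tri_solve_upto d y n : nat -> R[i] :=
  if n is n'.+1 then fun k =>
    if k == n' then (y n' + L (tri_solve_upto d y n') n') / d n'
    else tri_solve_upto d y n' k
  else 0.

Definition tri_solve d y : nat -> R[i] := fun n => tri_solve_upto d y n.+1 n.

Lemma tri_solve_uptoE d y n k : (k < n)%N -> tri_solve_upto d y n k = tri_solve d y k.
Proof.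
elim: n => // n IH; rewrite ltnS leq_eqVlt => /predU1P[->//|kn].
by rewrite [LHS]/= ltn_eqF// IH.
Qed.

Lemma tri_solveP d y n : d n != 0 ->
  d n * tri_solve d y n = y n + L (tri_solve d y) n.
Proof.
move=> dn0; rewrite {1}/tri_solve/= eqxx mulrC divfK//; congr (_ + _ / _).
apply: eq_big_nat => k /andP[_ kn]; congr (_ * _).
exact: tri_solve_uptoE.
Qed.

(** Once the earlier entries vanish, row [n] reads $x_n/(n+1) = l x_n$. *)
Lemma gen_cesaro_eigen_eq0 (l : R[i]) x : ~ Lambda R l -> C x = l *: x -> x = 0.
Proof.
move=> lL Cx; apply/funext; elim/ltn_ind => n IH.
have := congr1 (@^~ n) Cx; rewrite gen_cesaroE /strict_cesaro big_nat big1.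
  move=> /eqP; rewrite mul0r add0r fctE -subr_eq0 -mulrBl mulf_eq0.
  case/orP => [|/eqP//]; rewrite subr_eq0 => /eqP nl.
  by exfalso; apply: lL; exists n.
by move=> k /andP[_ kn]; rewrite IH// mulr0.
Qed.

Lemma pos_min (f : nat -> R) N : (forall n, 0 < f n) ->
  exists2 e, 0 < e & forall n, (n < N)%N -> e <= f n.
Proof.
move=> f0; elim: N => [|N [e e0 ef]]; first by exists 1.
exists (Num.min e (f N)) => [|n]; first by rewrite lt_min e0 f0.
rewrite ltnS leq_eqVlt ge_min => /predU1P[->|/ef->//].
by rewrite lexx orbT.
Qed.

(** Eventually $|d_n|\ge |l|/2$, and the finitely many other values have a positive minimum. Entries
    before [N] are left free because the eigenvector construction alters one of them. *)
Lemma diagonal_away_from0 (l : R[i]) d N : l != 0 -> (forall n, d n != 0) ->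
  (forall n, (N <= n)%N -> d n = l - n.+1%:R^-1) ->
  exists2 e, 0 < e & forall n, e <= cabs (d n).
Proof.
move=> l0 d0 dN; have cl0 : 0 < cabs l by rewrite cabs_gt0.
pose K := maxn N (Num.truncn (2 / cabs l)).
have [|e e0 ed] := @pos_min (fun n => cabs (d n)) K; first by move=> n; rewrite /= cabs_gt0.
exists (Num.min e (cabs l / 2)) => [|n]; first by rewrite lt_min e0 divr_gt0.
case: (ltnP n K) => [/ed nK|]; first by rewrite ge_min nK.
rewrite geq_max => /andP[Nn nl]; rewrite dN// ge_min; apply/orP; right.
have := cabsD (l - n.+1%:R^-1) n.+1%:R^-1; rewrite subrK cabsV cabs_nat.
suff nl2 : n.+1%:R^-1 <= cabs l / 2.
  move=> lD; rewrite -[leLHS](addrK (cabs l / 2)) -splitr lerBlDr.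
  by apply: le_trans lD _; rewrite lerD2l.
rewrite -[leRHS]invrK invf_div lef_pV2 ?posrE ?divr_gt0// ltW//.
by apply: lt_le_trans (truncnS_gt _) _; rewrite ler_nat ltnS.
Qed.

Hypotheses (t_ge0 : 0 <= t) (t_lt1 : t < 1).

(** In a weight for which [L] is bounded by [e / 2], half of the diagonal absorbs [L]; returning to
    [asum] costs the factor [W]. *)
Lemma tri_bound d (e : R) : 0 < e -> (forall n, e <= cabs (d n)) ->
  exists2 M, 0 <= M & forall x y,
    (forall n, d n * x n = y n + L x n) -> forall n, asum x n <= M * asum y n.
Proof.
move=> e0 ed.
have [|W [w [wW wL]]] := strict_cesaro_small t_ge0 t_lt1 (_ : 0 < e / 2).
  by rewrite divr_gt0.
have w0 k : 0 <= w k by have /andP[w1 _] := wW k; rewrite (le_trans ler01).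
exists (2 / e * W).
  have /andP[w1 wM] := wW 0%N.
  by rewrite mulr_ge0 ?divr_ge0 ?ltW// (lt_le_trans _ (le_trans w1 wM)).
move=> x y dxy n; apply: le_trans (asum_le_wsum x n wW) _.
rewrite -(mulrA (2 / e)); apply: (@le_trans _ _ (2 / e * wsum w y n)); last first.
  by rewrite ler_wpM2l ?divr_ge0 ?(ltW e0)//; exact: wsum_le_asum.
have : e * wsum w x n <= wsum w y n + e / 2 * wsum w x n.
  apply: (@le_trans _ _ (wsum w y n + wsum w (L x) n)); last by rewrite lerD2l wL.
  rewrite mulr_sumr -big_split/=; apply: ler_sum => k _.
  rewrite -mulrDr mulrCA ler_wpM2l//.
  apply: (le_trans _ (cabsD _ _)); rewrite -dxy cabsM ler_wpM2r ?cabs_ge0//.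
move: (wsum w x n) (wsum w y n) => X Y h; rewrite mulrAC ler_pdivlMr//; lra.
Qed.

Lemma gen_cesaro_resolvent (l : R[i]) : ~ Lambda0 R l ->
  exists2 M, 0 <= M & forall y, exists2 x, l *: x - C x = y &
    forall n, asum x n <= M * asum y n.
Proof.
move=> lL; pose d n := l - n.+1%:R^-1.
have l0 : l != 0 by apply/eqP => l0; apply: lL; right.
have d0 n : d n != 0.
  by rewrite subr_eq0; apply/eqP => ln; apply: lL; left; exists n.
have [e e0 ed] := @diagonal_away_from0 l d 0%N l0 d0 (fun n _ => erefl).
have [M M0 dM] := tri_bound e0 ed; exists M => // y.
have xP n := tri_solveP y (d0 n).
exists (tri_solve d y) => [|n]; last exact: dM.
apply/funext => n; rewrite !fctE gen_cesaroE.
have /eqP := xP n; rewrite mulrBl subr_eq => /eqP xn.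
by rewrite [l *: _]xn -(addrA (y n)) addrK.
Qed.

(** The vanishing diagonal entry at [m] is replaced by 1 and the right-hand side is [unit_seq m].
    The solution vanishes before [m] and equals 1 there, so it also solves the original singular
    system. *)
Lemma gen_cesaro_eigenvector m : exists M v, [/\ 0 <= M, v m = 1,
  C v = m.+1%:R^-1 *: v & forall n, asum v n <= M * asum (unit_seq R m) n].
Proof.
pose d n : R[i] := if n == m then 1 else m.+1%:R^-1 - n.+1%:R^-1.
have d0 n : d n != 0.
  rewrite /d; have [_|nm] := eqVneq n m; first by rewrite oner_eq0.
  rewrite subr_eq0; apply/eqP => /invr_inj/eqP.
  by rewrite eqr_nat eqSS eq_sym (negbTE nm).
have [||e e0 ed] := @diagonal_away_from0 m.+1%:R^-1 d m.+1 _ d0.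
- by rewrite invr_eq0 pnatr_eq0.
- by move=> n mn; rewrite /d gtn_eqF.
have [M M0 dM] := tri_bound e0 ed; pose v := tri_solve d (unit_seq R m).
have vP n : d n * v n = unit_seq R m n + L v n := tri_solveP _ (d0 n).
have vM n : asum v n <= M * asum (unit_seq R m) n by exact: dM.
(* The bound [vM] at [m] suffices: the partial sum of [unit_seq m] over the indices below [m] is
   0. *)
have v0 k : (k < m)%N -> v k = 0.
  move=> km; apply/eqP; rewrite -cabs_eq0 eq_le cabs_ge0 andbT.
  have := vM m; rewrite asum_unit ltnn mulr0; apply: le_trans.
  exact: cabs_le_asum.
have Lm : L v m = 0.
  by rewrite /strict_cesaro big_nat big1 ?mul0r// => k /andP[_ km]; rewrite v0 ?mulr0.
exists M, v; split => //.
  by have := vP m; rewrite /d /unit_seq eqxx mul1r Lm addr0.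
apply/funext => n; rewrite gen_cesaroE !fctE; have [->|nm] := eqVneq n m.
  by rewrite Lm add0r.
have := vP n; rewrite /d /unit_seq (negbTE nm) add0r => <-.
by rewrite -mulrDl subrK.
Qed.

End triangular_systems.

(** * Geometric convergence of the powers to the projection on the fixed vectors *)

Section powers.
Variables (R : realType) (t : R) (t_ge0 : 0 <= t) (t_lt1 : t < 1).
Implicit Types (x y : nat -> R[i]).
Local Notation C := (gen_cesaro t).

Lemma gen_cesaro_at0 x : C x 0 = x 0.
Proof. by rewrite /gen_cesaro big_nat1 expr0 mul1r invr1 mulr1. Qed.

Definition fix_proj x : nat -> R[i] := x 0 *: (fun k => t%:C%C ^+ k).

Lemma fix_projL a x y : fix_proj (a *: x + y) = a *: fix_proj x + fix_proj y.
Proof. by rewrite /fix_proj -[(a *: x + y) 0]/(a * x 0 + y 0) scalerDl scalerA. Qed.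

Lemma gen_cesaroB x y : C (x - y) = C x - C y.
Proof. by rewrite addrC -scaleN1r gen_cesaroL scaleN1r addrC. Qed.

Lemma gen_cesaroZ a x : C (a *: x) = a *: C x.
Proof.
have C0 : C 0 = 0 by rewrite -[in LHS](subrr 0) gen_cesaroB subrr.
by have := gen_cesaroL t a x 0; rewrite addr0 C0 addr0.
Qed.

Lemma gen_cesaro_fix_proj x : C (fix_proj x) = fix_proj x.
Proof.
rewrite /fix_proj gen_cesaroZ; congr (_ *: _); apply/funext => n.
rewrite /gen_cesaro (eq_big_nat _ _ (F2 := fun=> t%:C%C ^+ n)).
  by rewrite sumr_const_nat subn0 -(mulr_natr (t%:C%C ^+ n)) mulfK ?pnatr_eq0.
by move=> k /andP[_ kn]; rewrite -exprD subnK.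
Qed.

Lemma iter_gen_cesaro_sub m x :
  iter m C x - fix_proj x = iter m C (x - fix_proj x).
Proof.
elim: m => // m IH /=.
by rewrite -IH gen_cesaroB gen_cesaro_fix_proj.
Qed.

(** When $x_0=0$ only diagonal entries at most 1/2 act; a weight making the strict part at most 1/4
    leaves 3/4 in total. *)
Lemma gen_cesaro_contraction : exists W w, good_weight W w /\
  forall x, x 0 = 0 -> forall n, wsum w (C x) n <= 3 / 4 * wsum w x n.
Proof.
have [|W [w [wW wL]]] := strict_cesaro_small t_ge0 t_lt1 (_ : 0 < 4^-1).
  by rewrite invr_gt0.
exists W, w; split=> // x x0 n.
have -> : 3 / 4 * wsum w x n = 4^-1 * wsum w x n + 2^-1 * wsum w x n by lra.
apply: (@le_trans _ _ (wsum w (strict_cesaro t x) n + 2^-1 * wsum w x n)).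
  rewrite mulr_sumr -big_split/=; apply: ler_sum => k _.
  rewrite mulrCA -mulrDr ler_wpM2l//.
    by have /andP[w1 _] := wW k; rewrite (le_trans ler01).
  rewrite gen_cesaroE; apply: le_trans (cabsD _ _) _; rewrite lerD2l.
  case: k => [|k]; first by rewrite x0 mulr0 cabs0 mulr0.
  rewrite cabsM cabsV cabs_nat ler_wpM2r ?cabs_ge0// lef_pV2 ?posrE// ler_nat.
  exact: ltn0Sn.
by rewrite lerD2r wL.
Qed.

Lemma asum_fix_proj x n : asum (fix_proj x) n <= (1 - t)^-1 * asum x n.
Proof.
case: n => [|n]; first by rewrite /asum !big_geq ?mulr0.
rewrite asumZ mulrC; apply: ler_pM; rewrite ?asum_ge0 ?cabs_ge0//; last first.
  exact: cabs_le_asum.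
rewrite -[leRHS]div1r ler_pdivlMr ?subr_gt0// mulrC.
rewrite /asum; under eq_bigr do rewrite cabs_tX//.
rewrite big_mkord; have := subrX1 t n.+1.
move=> /(congr1 -%R); rewrite -mulNr !opprB => <-.
by rewrite lerBlDr lerDl exprn_ge0.
Qed.

(** The difference [x - fix_proj x] has zeroth entry 0, which [C] preserves, so the contraction can
    be iterated. The constant collects the change of weight and the bound of $I$ minus the
    projection. *)
Lemma iter_gen_cesaro_bound : exists2 M, 0 <= M & forall m x n,
  asum (iter m C x - fix_proj x) n <= M * (3 / 4) ^+ m * asum x n.
Proof.
have [W [w [wW wC]]] := gen_cesaro_contraction.
have W0 : 0 <= W by have /andP[w1 wM] := wW 0%N; rewrite (le_trans _ (le_trans w1 wM)).
have t0 : 0 <= (1 - t)^-1 by rewrite invr_ge0 subr_ge0 ltW.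
exists (W * (1 + (1 - t)^-1)); first by rewrite mulr_ge0 ?addr_ge0.
move=> m x n; rewrite iter_gen_cesaro_sub; set z := x - fix_proj x.
have z0 : z 0 = 0 by rewrite /z -[LHS]/(x 0 - x 0 * t%:C%C ^+ 0) expr0 mulr1 subrr.
have iz0 j : iter j C z 0 = 0 by elim: j => //= j IH; rewrite gen_cesaro_at0.
have wi : wsum w (iter m C z) n <= (3 / 4) ^+ m * wsum w z n.
  elim: m => [|m IH]; first by rewrite expr0 mul1r.
  by apply: le_trans (wC _ (iz0 m) n) _; rewrite exprS -(mulrA (3 / 4)) ler_wpM2l.
apply: le_trans (asum_le_wsum _ _ wW) _; apply: le_trans wi _.
rewrite -(mulrA _ ((3 / 4) ^+ m)) mulrCA ler_wpM2l ?exprn_ge0 ?divr_ge0//.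
apply: le_trans (wsum_le_asum _ _ wW) _; rewrite -mulrA ler_wpM2l//.
rewrite mulrDl mul1r; apply: le_trans (asumD _ _ _) _; rewrite lerD2l.
rewrite -scaleN1r asumZ cabsN cabs1 mul1r.
exact: asum_fix_proj.
Qed.

End powers.

(** * The operator on a solid sequence space *)

(** The properties shared by the three spaces from which the operator theory is derived. Solidity
    refers to Cesàro means, so that partial sum estimates transfer directly to the norm. *)
Record ideal_space (R : realType) (t : R) (S : seqspace R) : Prop := IdealSpace {
  ideal_solid : forall x y (M : R), 0 <= M -> ss_mem S x ->
    (forall n, cesaro_abs y n <= M * cesaro_abs x n) ->
    ss_mem S y /\ ss_norm S y <= M * ss_norm S x ;
  ideal_coord : forall x n, ss_mem S x -> cesaro_abs x n <= ss_norm S x ;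
  ideal_unit0 : ss_mem S (unit_seq R 0) ;
  ideal_fatou : forall x (M : R), ss_mem S x ->
    (forall N, ss_norm S (sec N x) <= M) -> ss_norm S x <= M ;
  (* [gen_cesaro t] maps even the "coordinatewise closure" of the ball into the
     space; for [ces_0] that closure is larger than the ball *)
  ideal_maps : forall x (M : R),
    (forall N, ss_norm S (sec N x) <= M) -> ss_mem S (gen_cesaro t x) }.

(** * Maps of sequences as operators on a normed sequence space *)

Section lifting.
Variables (R : realType) (S : seqspace R).
Implicit Types (f : (nat -> R[i]) -> nat -> R[i]) (x y : ss_type S).
Local Notation X := (ss_type S).

(** The value defaults to 0 where [f] leaves the space; every use goes with a proof of
    membership. *)
Definition lift_op f (x : X) : X := insubd (0 : X) (f (ss_val x)).

Lemma lift_opE f x : ss_mem S (f (ss_val x)) -> ss_val (lift_op f x) = f (ss_val x).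
Proof. by move=> fx; apply: (insubdK (0 : X)); rewrite inE. Qed.

Lemma rnorm_rV (x : X) : `|x| = (rnorm x)%:C%C. Proof. by []. Qed.

Lemma rnormD x y : rnorm (x + y) <= rnorm x + rnorm y.
Proof. exact: (ss_normD (ss_memP x) (ss_memP y)). Qed.

Lemma rnormZ (a : R[i]) x : rnorm (a *: x) = cabs a * rnorm x.
Proof. exact: (ss_normZ a (ss_memP x)). Qed.

Lemma rnorm0 : rnorm (0 : X) = 0.
Proof. by rewrite -(scale0r (0 : X)) rnormZ cabs0 mul0r. Qed.

Lemma rnormN x : rnorm (- x) = rnorm x.
Proof. by rewrite -scaleN1r rnormZ cabsN cabs1 mul1r. Qed.

Lemma rnorm_ge0 x : 0 <= rnorm x.
Proof.
have := rnormD x (- x); rewrite subrr rnorm0 rnormN -mulr2n.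
by rewrite pmulrn_lge0.
Qed.

Lemma rnorm_sum I (r : seq I) (P : pred I) (F : I -> X) :
  rnorm (\sum_(i <- r | P i) F i) <= \sum_(i <- r | P i) rnorm (F i).
Proof.
elim/big_ind2 : _ => [|x1 x2 y1 y2 h1 h2|//]; first by rewrite rnorm0.
exact: le_trans (rnormD _ _) (lerD h1 h2).
Qed.

Lemma opnorm_le (F : X -> X) (M : R) : 0 <= M ->
  (forall x, rnorm (F x) <= M * rnorm x) -> (opnorm F <= M%:E)%E.
Proof.
move=> M0 FM; apply: ge_ereal_sup => _ [x /= x1 <-].
by rewrite lee_fin (le_trans (FM x))// ler_piMr.
Qed.

Lemma opnorm_ge0 (F : X -> X) : (0 <= opnorm F)%E.
Proof.
apply: (@le_trans _ _ (rnorm (F 0))%:E); first by rewrite lee_fin rnorm_ge0.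
by apply: ereal_sup_ubound; exists 0 => //=; rewrite rnorm0 ler01.
Qed.

Lemma bounded_operator0 (F : X -> X) : bounded_operator F -> F 0 = 0.
Proof.
by move=> [linF _]; have := linF (-1) 0 0; rewrite scaler0 addr0 scaleN1r addNr.
Qed.

End lifting.

(** * Spectra, power boundedness, mean ergodicity and supercyclicity *)

Section operator_on_ideal_space.
Variables (R : realType) (t : R) (t_ge0 : 0 <= t) (t_lt1 : t < 1).
Variables (S : seqspace R) (idS : ideal_space t S).
Implicit Types (u v : nat -> R[i]).
Local Notation C := (gen_cesaro t).
Local Notation X := (ss_type S).

Lemma solid_asum u v (M : R) : 0 <= M -> ss_mem S u ->
  (forall n, asum v n <= M * asum u n) ->
  ss_mem S v /\ ss_norm S v <= M * ss_norm S u.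
Proof. by move=> M0 Su vu; apply: (ideal_solid idS) => //; exact: cesaro_abs_leM. Qed.

Lemma cabs_coord u k : ss_mem S u -> cabs (u k) <= k.+1%:R * ss_norm S u.
Proof.
move=> Su; have := ideal_coord idS k Su.
rewrite -ler_pdivrMl// => /(le_trans _); apply.
by rewrite ler_wpM2l//; exact: cabs_le_asum.
Qed.

Lemma sec_mem N u : ss_mem S (sec N u) /\
  ss_norm S (sec N u) <= asum u N * ss_norm S (unit_seq R 0).
Proof.
apply: solid_asum; [exact: asum_ge0|exact: ideal_unit0 idS|exact: asum_sec_le].
Qed.

Lemma unit_mem m : ss_mem S (unit_seq R m).
Proof.
have [] // := @solid_asum (unit_seq R 0) (unit_seq R m) 1 ler01 (ideal_unit0 idS).
by case=> [|n]; rewrite mul1r !asum_unit ler_nat// leq_b1.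
Qed.

Lemma lift_asum (f : (nat -> R[i]) -> nat -> R[i]) (M : R) : 0 <= M ->
  (forall u n, asum (f u) n <= M * asum u n) ->
  forall x : X, ss_val (lift_op f x) = f (ss_val x) /\
    rnorm (lift_op f x) <= M * rnorm x.
Proof.
move=> M0 fM x; have [Sf fx] := solid_asum M0 (ss_memP x) (fM (ss_val x)).
by rewrite !rnormE lift_opE.
Qed.

Lemma lift_bounded (f : (nat -> R[i]) -> nat -> R[i]) (M : R) : 0 <= M ->
  (forall u n, asum (f u) n <= M * asum u n) ->
  (forall a u v, f (a *: u + v) = a *: f u + f v) ->
  bounded_operator (lift_op f : X -> X).
Proof.
move=> M0 fM linf; split; last by exists M => x; have [] := lift_asum M0 fM x.
move=> a x y; apply: val_inj.
rewrite [LHS](lift_asum M0 fM _).1 [RHS]/(a *: ss_val (lift_op f x) + ss_val (lift_op f y)).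
by rewrite !(lift_asum M0 fM _).1; exact: linf.
Qed.

Definition cesaro_op : X -> X := lift_op C.

Let t1V : 0 <= (1 - t)^-1. Proof. by rewrite invr_ge0 subr_ge0 ltW. Qed.

Lemma cesaro_opE (x : X) : ss_val (cesaro_op x) = C (ss_val x).
Proof. by have [] := lift_asum t1V (asum_gen_cesaro t_ge0 t_lt1) x. Qed.

Lemma cesaro_op_le (x : X) : rnorm (cesaro_op x) <= (1 - t)^-1 * rnorm x.
Proof. by have [] := lift_asum t1V (asum_gen_cesaro t_ge0 t_lt1) x. Qed.

Lemma cesaro_op_bounded : bounded_operator cesaro_op.
Proof. exact: lift_bounded t1V (asum_gen_cesaro t_ge0 t_lt1) (gen_cesaroL t). Qed.

Lemma iter_cesaro_op m (x : X) : ss_val (iter m cesaro_op x) = iter m C (ss_val x).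
Proof. by elim: m => //= m IH; rewrite cesaro_opE IH. Qed.

Lemma cesaro_op_eigenvector m : exists2 x : X, x != 0 &
  cesaro_op x = m.+1%:R^-1 *: x.
Proof.
have [M [v [M0 vm Cv vM]]] := gen_cesaro_eigenvector t_ge0 t_lt1 m.
have [Sv _] := solid_asum M0 (unit_mem m) vM.
exists (SSType (mem_set Sv : v \in ss_pred S)); last first.
  by apply: val_inj; rewrite [LHS]cesaro_opE.
apply/eqP => /(congr1 (fun x : X => ss_val x m)) /= /eqP.
by rewrite vm oner_eq0.
Qed.

Lemma cesaro_op_point_spectrum : point_spectrum cesaro_op = Lambda R.
Proof.
apply/seteqP; split => [l [x x0 Tx]|_ [m _ <-]]; last exact: cesaro_op_eigenvector.
apply: contrapT => lL; move/eqP: x0; apply; apply: val_inj.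
apply: (gen_cesaro_eigen_eq0 lL).
exact: (etrans (esym (cesaro_opE x)) (congr1 (@ss_val _ _) Tx)).
Qed.

Lemma cesaro_op_resolvent l : ~ Lambda0 R l -> resolvent_set cesaro_op l.
Proof.
move=> lL; have [M M0 lM] := gen_cesaro_resolvent t_ge0 t_lt1 lL.
have [g gP] := choice (fun v => let: ex_intro2 u a b := lM v in
  ex_intro (fun u => l *: u - C u = v /\ forall n, asum u n <= M * asum v n) u (conj a b)).
(* Uniqueness holds since [l] is no eigenvalue; it gives linearity of the chosen solution map [g]
   and the left inverse identity. *)
have ginj u v : l *: u - C u = l *: v - C v -> u = v.
  move=> uv; apply/eqP; rewrite -subr_eq0; apply/eqP.
  apply: (@gen_cesaro_eigen_eq0 _ t l) => [lL'|]; first by apply: lL; left.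
  have -> : C (u - v) = l *: u - (l *: v - C v) - C v.
    by rewrite gen_cesaroB -uv subKr.
  by rewrite scalerBr opprB addrCA addrAC subrr add0r.
have linf a u v : g (a *: u + v) = a *: g u + g v.
  apply: ginj; rewrite (gP _).1 gen_cesaroL scalerDr scalerA [l * a]mulrC -scalerA.
  by rewrite opprD addrACA -scalerBr !(gP _).1.
exists (lift_op g : X -> X).
  by apply: (lift_bounded M0) => // u n; have [] := gP u.
have gE x : ss_val (lift_op g x : X) = g (ss_val x).
  by have [] := lift_asum M0 (fun u => (gP u).2) x.
move=> x; split; apply: val_inj.
  suff : ss_val (lift_op g (l *: x - cesaro_op x)) = ss_val x by [].
  by apply: ginj; rewrite gE (gP _).1 -cesaro_opE.
suff : l *: ss_val (lift_op g x) - ss_val (cesaro_op (lift_op g x)) = ss_val x by [].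
by rewrite cesaro_opE gE (gP _).1.
Qed.

Lemma unit_norm_gt0 m : 0 < ss_norm S (unit_seq R m).
Proof.
have := cabs_coord m (unit_mem m); rewrite /unit_seq eqxx cabs1.
by rewrite -ler_pdivrMl// => /(lt_le_trans _); apply; rewrite mulr1 invr_gt0.
Qed.

Lemma gen_cesaro_unit N k : (k < N)%N -> C (unit_seq R N) k = 0.
Proof.
move=> kN; rewrite /gen_cesaro big_nat big1 ?mul0r// => j /andP[_ jk].
by rewrite /unit_seq ltn_eqF ?mulr0//; exact: leq_trans jk kN.
Qed.

(** The image of [unit_seq N] vanishes before [N], so it coincides with its own tail. *)
Lemma cesaro_op_unit_small N :
  ss_norm S (C (unit_seq R N)) <= N.+1%:R^-1 / (1 - t) * ss_norm S (unit_seq R N).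
Proof.
have [//|//|n|//] := @solid_asum (unit_seq R N) (C (unit_seq R N)) (N.+1%:R^-1 / (1 - t)).
- by rewrite mulr_ge0.
- exact: unit_mem.
apply: le_trans (asum_gen_cesaro_tail t_ge0 t_lt1 N _ _).
rewrite (_ : tail N _ = C (unit_seq R N))//.
by apply/funext => k; rewrite /tail; case: ltnP => // /gen_cesaro_unit ->.
Qed.

Lemma cesaro_op_spectrum : spectrum cesaro_op = Lambda0 R.
Proof.
apply/seteqP; split => [l lr|l].
  by apply: contrapT => lL; apply: lr; exact: cesaro_op_resolvent.
move=> [[m _ <-]|->] [F bF FT].
  (* A resolvent would send $0 = lx - Tx$ back to the eigenvector. *)
  have [x x0 Tx] := cesaro_op_eigenvector m.
  have [] := FT x; rewrite Tx subrr (bounded_operator0 bF) => x0' _.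
  by rewrite -x0' eqxx in x0.
(* For [l = 0] a bounded inverse would give $\|e\|\le |M|\,\|Ce\|\le \frac{|M|}{(N+1)(1-t)}\|e\|$ at
   the unit sequence of index [N]; this [N] makes the factor less than 1. *)
have [linF [M FM]] := bF; pose N := Num.truncn (`|M| / (1 - t)).
pose e : X := SSType (mem_set (unit_mem N) : _ \in ss_pred S).
have [Fe _] := FT e; have := FM (0 *: e - cesaro_op e); rewrite Fe scale0r sub0r rnormN.
have e0 : 0 < rnorm e by exact: unit_norm_gt0.
apply/negP; rewrite -ltNge.
apply: (@le_lt_trans _ _ (`|M| * (N.+1%:R^-1 / (1 - t) * rnorm e))).
  apply: le_trans (ler_wpM2r (rnorm_ge0 _) (ler_norm M)) (ler_wpM2l (normr_ge0 M) _).
  by rewrite rnormE cesaro_opE; exact: cesaro_op_unit_small.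
rewrite mulrA gtr_pMl// mulrCA mulrC ltr_pdivrMr// mul1r.
exact: truncnS_gt.
Qed.

Lemma geom_sum_le n : \sum_(1 <= m < n.+1) (3 / 4 : R) ^+ m <= 4.
Proof.
have -> : \sum_(1 <= m < n.+1) (3 / 4 : R) ^+ m = 3 - 4 * (3 / 4) ^+ n.+1.
  elim: n => [|n IH]; first by rewrite big_geq// expr1; lra.
  rewrite big_nat_recr//= IH [in RHS]exprS; set q := _ ^+ _; lra.
have : 0 <= (3 / 4 : R) ^+ n.+1 by rewrite exprn_ge0.
by set q := _ ^+ _; lra.
Qed.

Definition fix_op : X -> X := lift_op (@fix_proj R t).

Lemma fix_op_bounded : bounded_operator fix_op.
Proof. exact: lift_bounded t1V (asum_fix_proj t_ge0 t_lt1) (fix_projL t). Qed.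

Lemma fix_opE (x : X) : ss_val (fix_op x) = fix_proj t (ss_val x).
Proof. by have [] := lift_asum t1V (asum_fix_proj t_ge0 t_lt1) x. Qed.

Lemma fix_op_le (x : X) : rnorm (fix_op x) <= (1 - t)^-1 * rnorm x.
Proof. by have [] := lift_asum t1V (asum_fix_proj t_ge0 t_lt1) x. Qed.

Lemma iter_cesaro_op_bound : exists2 M, 0 <= M & forall m (x : X),
  rnorm (iter m cesaro_op x - fix_op x) <= M * (3 / 4) ^+ m * rnorm x.
Proof.
have [M M0 MP] := iter_gen_cesaro_bound t_ge0 t_lt1; exists M => // m x.
have [] := @solid_asum (ss_val x) (iter m C (ss_val x) - fix_proj t (ss_val x))
  (M * (3 / 4) ^+ m) _ (ss_memP x) (MP m _); first by rewrite mulr_ge0 ?exprn_ge0.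
move=> _; apply: le_trans; rewrite rnormE.
rewrite -[ss_val _]/(ss_val (iter m cesaro_op x) - ss_val (fix_op x)).
by rewrite iter_cesaro_op fix_opE.
Qed.

Lemma cesaro_op_power_bounded : power_bounded cesaro_op.
Proof.
have [M M0 MP] := iter_cesaro_op_bound.
apply: (@le_lt_trans _ _ (M + (1 - t)^-1)%:E); last exact: ltry.
apply: ge_ereal_sup => _ [m _ <-]; apply: opnorm_le => [|x]; first by rewrite addr_ge0.
rewrite -(subrK (fix_op x) (iter m _ x)) mulrDl.
apply: le_trans (rnormD _ _) (lerD _ (fix_op_le x)).
apply: le_trans (MP m x) _; rewrite ler_wpM2r ?rnorm_ge0// ler_piMr//.
by rewrite exprn_ile1//; lra.
Qed.

(** The mean minus the projection is the average of the differences $T^m-P$, whose geometric bounds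
    sum to at most $4M$; the norm is therefore $O(1/n)$. *)
Lemma cesaro_op_ume : uniformly_mean_ergodic cesaro_op.
Proof.
have [M M0 MP] := iter_cesaro_op_bound.
exists fix_op; first exact: fix_op_bounded.
rewrite -cvg_shiftS.
have h0 : (M * 4 * harmonic n)%:E @[n --> \oo] --> (0 : \bar R)%E.
  apply/fine_cvgP; split; first exact: nearW.
  rewrite -[X in _ --> X](mulr0 (M * 4)); apply: cvgMl_tmp.
  exact: cvg_harmonic.
apply: (squeeze_cvge _ (cvg_cst (0 : \bar R)%E) h0).
apply: nearW => n; rewrite opnorm_ge0/=; apply: opnorm_le => [|x].
  by rewrite !mulr_ge0// invr_ge0.
have -> : ergodic_mean cesaro_op n.+1 x - fix_op x =
    n.+1%:R^-1 *: \sum_(1 <= m < n.+2) (iter m cesaro_op x - fix_op x).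
  rewrite sumrB scalerBr sumr_const_nat subSS subn0.
  rewrite -[fix_op x *+ _]scaler_nat scalerA.
  by rewrite mulVf ?scale1r// pnatr_eq0.
rewrite rnormZ cabsV cabs_nat.
have -> : M * 4 / n.+1%:R * rnorm x = n.+1%:R^-1 * (M * 4 * rnorm x).
  by rewrite [LHS]mulrAC [LHS]mulrC.
rewrite ler_wpM2l//.
apply: le_trans (rnorm_sum _ _ _) _.
apply: (@le_trans _ _ (\sum_(1 <= m < n.+2) M * rnorm x * (3 / 4) ^+ m)).
  by apply: ler_sum => m _; rewrite mulrAC; exact: MP.
rewrite -mulr_sumr [leRHS]mulrAC ler_wpM2l ?mulr_ge0 ?rnorm_ge0//.
exact: geom_sum_le.
Qed.

(* [u 0] and [u 1 - t u 0] are eigenfunctionals of [C] for 1 and 1/2, so their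
   quotient stays bounded along the projective orbit. *)
Lemma cesaro_op_not_supercyclic : ~ supercyclic cesaro_op.
Proof.
pose f1 (u : nat -> R[i]) := u 1 - t%:C%C * u 0.
have f1C u : f1 (C u) = 2^-1 * f1 u.
  rewrite /f1 gen_cesaro_at0 /gen_cesaro big_nat_recr//= big_nat1 !expr1 expr0.
  by field.
have f1_iter n u : cabs (f1 (iter n C u)) <= cabs (f1 u).
  elim: n => //= n IH; rewrite f1C cabsM cabsV cabs_nat.
  by apply: le_trans IH; rewrite ler_piMl ?cabs_ge0// invf_le1// ler1n.
have C0_iter n u : iter n C u 0 = u 0.
  by elim: n => //= n IH; rewrite gen_cesaro_at0.
move=> [x xdense]; pose a := cabs (x 0); pose b := cabs (f1 x).
(* The bound on the quotient is written without division, hence is homogeneous in [y]. *)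
have orbit (l : R[i]) n : let y := ss_val (l *: iter n cesaro_op x) in
    a * cabs (f1 y) <= b * cabs (y 0).
  rewrite -[ss_val _]/(l *: ss_val (iter n cesaro_op x)) iter_cesaro_op /=.
  have -> : f1 (l *: iter n C x) = l * f1 (iter n C x).
    by rewrite /f1 mulrBr mulrCA.
  rewrite -[(l *: _) 0]/(l * iter n C x 0) C0_iter !cabsM mulrCA [leRHS]mulrCA.
  by rewrite ler_wpM2l ?cabs_ge0// mulrC ler_wpM2r ?cabs_ge0.
have near_orbit m (e : R) : 0 < e -> exists y : X, [/\ x 0 = 0 -> y 0%N = 0,
    a * cabs (f1 y) <= b * cabs (y 0), cabs (y 0 - unit_seq R m 0) <= e &
    cabs (y 1 - unit_seq R m 1) <= 2 * e].
  move=> e0; pose z : X := SSType (mem_set (unit_mem m) : _ \in ss_pred S).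
  have [||y [zy [l _ [n _ yE]]]] := xdense (ball z e%:C%C).
  - exists z; apply: ballxx; exact: realC_gt0.
  - exact: ball_open.
  have {}zy : rnorm (y - z) <= e.
    by move: zy; rewrite -ball_normE /= distrC rnorm_rV ltcR => /ltW.
  exists y; split; first 1 last.
  - by rewrite -yE; exact: orbit.
  - by have := cabs_coord 0 (ss_memP (y - z)); rewrite mul1r => /le_trans; apply.
  - apply: le_trans (cabs_coord 1 (ss_memP (y - z))) _.
    by rewrite ler_wpM2l.
  - move=> x0; rewrite -yE -[LHS]/(l * ss_val (iter n cesaro_op x) 0).
    by rewrite iter_cesaro_op C0_iter x0 mulr0.
(* If $x_0=0$, the whole projective orbit has zeroth entry 0 and stays away from [unit_seq 0]. *)
have [x0|x0] := eqVneq (x 0) 0.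
  have [|y [/(_ x0) -> _ + _]] := near_orbit 0 2^-1; first by rewrite invr_gt0.
  by rewrite sub0r cabsN cabs1 invf_ge1// lern1.
have a0 : 0 < a by rewrite cabs_gt0.
have b0 : 0 <= b by exact: cabs_ge0.
(* Approximating [unit_seq 1] up to [e] forces $a(1-3e)\le be$, that is $a\le e(b+3a)$; this choice
   of [e] makes the right side less than $a/2$. *)
pose e := a / (2 * b + 6 * a + 1).
have d0 : 0 < 2 * b + 6 * a + 1 by lra.
have e0 : 0 < e by rewrite divr_gt0.
have [y [_ yab]] := near_orbit 1 e e0.
rewrite subr0 => y0 y1.
have f1y : 1 - 3 * e <= cabs (f1 y).
  have : cabs (1 : R[i]) <= cabs (y 1 - 1) + (cabs (f1 y) + cabs (y 0)).
    rewrite [leLHS](_ : _ = cabs (- (y 1 - 1) + (f1 y + t%:C%C * y 0))); last first.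
      by rewrite subrK opprB subrK.
    rewrite (le_trans (cabsD _ _))// cabsN lerD2l (le_trans (cabsD _ _))//.
    by rewrite lerD2l cabsM cabs_real// ler_piMl ?cabs_ge0// ltW.
  by rewrite cabs1; lra.
have ed : e * (2 * b + 6 * a + 1) = a by rewrite divfK// gt_eqF.
have : a * (1 - 3 * e) <= b * e.
  by apply: le_trans (le_trans yab _); rewrite ler_wpM2l// ltW.
nra.
Qed.

End operator_on_ideal_space.

(** * Compactness through the topology of coordinatewise convergence *)

Section compactness.
Variables (R : realType) (t : R) (t_ge0 : 0 <= t) (t_lt1 : t < 1).
Variables (S : seqspace R) (idS : ideal_space t S).
Implicit Types (u v : nat -> R[i]).
Local Notation C := (gen_cesaro t).
Local Notation X := (ss_type S).

(** Complex sequences are coded by real coordinates, [true] for real and [false] for imaginary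
    parts, so that Tychonoff's theorem applies to a product of real segments. *)
Let W : topologicalType := prod_topology (fun _ : (nat * bool)%type => R).

Definition cplx_seq (f : W) : nat -> R[i] := fun n => (f (n, true) +i* f (n, false))%C.

(** Bounding all sections, rather than the sequence itself, gives a set closed under coordinatewise
    convergence. *)
Definition coord_ball : set W := [set f | forall N, ss_norm S (sec N (cplx_seq f)) <= 1].

Definition coord_box : set W :=
  [set f | forall i, `[- i.1.+1%:R, i.1.+1%:R]%classic (f i)].

Let norm0 := ss_norm S (unit_seq R 0).

Lemma secB N u v : sec N (u - v) = sec N u - sec N v.
Proof. by apply/funext => k; rewrite /sec !fctE; case: ifP => // _; rewrite subrr. Qed.

Lemma ss_normD_le u v w : ss_mem S u -> ss_mem S v -> w = u + v ->
  ss_norm S w <= ss_norm S u + ss_norm S v.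
Proof. by move=> Su Sv ->; exact: ss_normD. Qed.

Lemma near_cplx_seq (f : W) N (e : R) : 0 < e ->
  \forall g \near f, asum (cplx_seq f - cplx_seq g) N < e.
Proof.
move=> e0; elim: N e e0 => [|N IH] e e0; first by near=> g; rewrite /asum big_geq.
have e3 : 0 < e / 3 by rewrite divr_gt0.
have pc i : \forall g \near f, `|f i - g i| < e / 3.
  have pi : (fun g : W => g i : R) @ nbhs f --> (f i : R).
    exact: (@proj_continuous _ (fun _ : (nat * bool)%type => R) i f).
  by move/cvgrPdist_lt : pi; apply.
near=> g; rewrite /asum big_nat_recr//= -/(asum _ _).
have h1 : asum (cplx_seq f - cplx_seq g) N < e / 3 by near: g; exact: IH.
have h2 : `|f (N, true) - g (N, true)| < e / 3 by near: g; exact: pc.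
have h3 : `|f (N, false) - g (N, false)| < e / 3 by near: g; exact: pc.
have := le_cabs_ReIm (f (N, true) - g (N, true)) (f (N, false) - g (N, false)).
by move=> h4; apply: le_lt_trans (lerD (ltW h1) h4) _; lra.
Unshelve. all: by end_near. Qed.

(** Each condition involves finitely many coordinates, and the norm of a section is controlled by
    its partial sum times [norm0]. *)
Lemma coord_ball_closed : closed coord_ball.
Proof.
move=> f clf N; apply/ler_addgt0Pr => e e0.
have n0 : 0 < norm0 by exact: unit_norm_gt0 idS 0.
have [g [gB fg]] := clf _ (near_cplx_seq f N (divr_gt0 e0 n0)).
apply: le_trans (lerD (gB N)
  (ltW (_ : asum (cplx_seq f - cplx_seq g) N * norm0 < e))); last first.
  by rewrite -ltr_pdivlMr.
have [S1 _] := sec_mem idS N (cplx_seq g).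
have [S2 n2] := sec_mem idS N (cplx_seq f - cplx_seq g).
have := @ss_normD_le _ _ (sec N (cplx_seq f)) S1 S2.
rewrite secB addrC subrK => /(_ erefl) /le_trans; apply.
by rewrite -secB lerD2l.
Qed.

Lemma coord_ball_compact : compact (coord_box `&` coord_ball).
Proof.
apply: compact_closedI coord_ball_closed.
exact: (@tychonoff (nat * bool)%type (fun=> R)
  (fun i => `[- i.1.+1%:R, i.1.+1%:R]%classic) (fun i => @segment_compact R _ _)).
Qed.

(** The sequence of [f] may lie outside the space, so the tail estimate is applied to its sections
    and carried over by [ideal_fatou]. *)
Lemma tail_ball N (f : W) : coord_ball f ->
  ss_mem S (C (cplx_seq f)) /\ ss_mem S (tail N (C (cplx_seq f))) /\
  ss_norm S (tail N (C (cplx_seq f))) <= N.+1%:R^-1 / (1 - t).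
Proof.
move=> fB; have SC := ideal_maps idS fB.
have St : ss_mem S (tail N (C (cplx_seq f))).
  have [] // := @solid_asum _ _ _ idS (C (cplx_seq f)) (tail N (C (cplx_seq f))) 1 ler01 SC.
  move=> n; rewrite mul1r; apply: ler_sum => k _; rewrite /tail.
  by case: ifP => // _; rewrite cabs0 cabs_ge0.
split=> //; split=> //; apply: (ideal_fatou idS St) => n.
have e0 : 0 <= N.+1%:R^-1 / (1 - t) by rewrite divr_ge0 ?subr_ge0 ?ltW.
have [Sf _] := sec_mem idS n (cplx_seq f).
have [] := @solid_asum _ _ _ idS _ (sec n (tail N (C (cplx_seq f)))) _ e0 Sf.
  by move=> m; rewrite !asum_sec; exact: asum_gen_cesaro_tail.
by move=> _ /le_trans; apply; rewrite ler_piMr.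
Qed.

Definition cesaro_of_coord (f : W) : X := insubd (0 : X) (C (cplx_seq f)).

Lemma cesaro_of_coordE f : coord_ball f ->
  ss_val (cesaro_of_coord f) = C (cplx_seq f).
Proof. by move=> /(tail_ball 0)[Sf _]; apply: (insubdK (0 : X)); rewrite inE. Qed.

(** The difference is cut at [N]: the head depends on finitely many coordinates, and both tails are
    uniformly small. *)
Lemma cesaro_of_coord_dist (f g : W) N : coord_ball f -> coord_ball g ->
  rnorm (cesaro_of_coord f - cesaro_of_coord g) <=
  (1 - t)^-1 * asum (cplx_seq f - cplx_seq g) N * norm0 +
    2 * (N.+1%:R^-1 / (1 - t)).
Proof.
move=> fB gB; rewrite rnormE.
rewrite -[ss_val _]/(ss_val (cesaro_of_coord f) - ss_val (cesaro_of_coord g)).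
rewrite !cesaro_of_coordE//.
have [Sf [Sf' nf]] := tail_ball N fB; have [Sg [Sg' ng]] := tail_ball N gB.
set z := cplx_seq f - cplx_seq g.
have [Sz nz] := sec_mem idS N (C z).
have SgN : ss_mem S (- tail N (C (cplx_seq g))).
  by rewrite -scaleN1r -[_ *: _]addr0; apply: ss_memL => //; exact: ss_mem0.
have nzN : ss_norm S (- tail N (C (cplx_seq g))) = ss_norm S (tail N (C (cplx_seq g))).
  by rewrite -scaleN1r ss_normZ// cabsN cabs1 mul1r.
have Stt : ss_mem S (tail N (C (cplx_seq f)) - tail N (C (cplx_seq g))).
  by rewrite -[tail N (C (cplx_seq f))]scale1r; exact: ss_memL.
have E : C (cplx_seq f) - C (cplx_seq g) =
    sec N (C z) + (tail N (C (cplx_seq f)) - tail N (C (cplx_seq g))).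
  rewrite /z gen_cesaroB; apply/funext => k; rewrite /sec /tail !fctE.
  by case: ifP => _; rewrite ?subrr ?addr0 ?add0r.
apply: le_trans (ss_normD_le Sz Stt E) _; apply: lerD.
  apply: le_trans nz _; rewrite ler_wpM2r//.
    exact/ltW/(unit_norm_gt0 idS 0).
  exact: asum_gen_cesaro.
apply: le_trans (ss_normD_le Sf' SgN erefl) _.
by rewrite nzN mulr_natl mulr2n lerD.
Qed.

Lemma cesaro_of_coord_continuous :
  {within coord_box `&` coord_ball, continuous cesaro_of_coord}.
Proof.
apply/subspace_continuousP => f [_ fB]; apply/cvgrPdist_lt => e e0.
(* The radius [e] lives in [R[i]]; being positive it is real. *)
have eR : e = (complex.Re e)%:C%C by rewrite RRe_real// gtr0_real.
have r0 : 0 < complex.Re e.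
  by move: e0; rewrite [e in X in X -> _]eR -[ltLHS]/((0 : R)%:C%C) ltcR.
have n0 : 0 < norm0 by exact: unit_norm_gt0 idS 0.
have t0 : 0 < 1 - t by rewrite subr_gt0.
set r := complex.Re e in eR r0.
(* This [N] keeps the two tails below [r / 2]; the neighbourhood of [f] chosen below gives the other
   half. *)
pose N := Num.truncn (4 / (r * (1 - t))).
have N1 : 2 * (N.+1%:R^-1 / (1 - t)) < r / 2.
  have : 4 / (r * (1 - t)) < N.+1%:R := truncnS_gt _.
  rewrite ltr_pdivrMr ?mulr_gt0// => h.
  rewrite mulrA ltr_pdivrMr// ltr_pdivrMr//.
  by move: (N.+1%:R : R) h => K h; lra.
rewrite near_withinE.
have d0 : 0 < r / 2 * (1 - t) / norm0 by rewrite !divr_gt0// mulr_gt0// divr_gt0.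
apply: filterS (near_cplx_seq f N d0) => g gd [_ gB].
rewrite rnorm_rV eR ltcR; apply: le_lt_trans (cesaro_of_coord_dist N fB gB) _.
rewrite [ltRHS]splitr ltrD// -mulrA ltr_pdivrMl// [ltRHS]mulrC.
by rewrite -ltr_pdivlMr.
Qed.

Lemma coord_ball_contains (x : X) : rnorm x <= 1 ->
  exists2 f, (coord_box `&` coord_ball) f & cplx_seq f = ss_val x.
Proof.
move=> x1; have Sx := ss_memP x.
pose f : W := fun i => if i.2 then complex.Re (ss_val x i.1) else complex.Im (ss_val x i.1).
have fx : cplx_seq f = ss_val x.
  by apply/funext => n; rewrite /cplx_seq /f/=; case: (ss_val x n).
exists f => //; split=> [[n b]|N]; last first.
  rewrite fx; have [] := @solid_asum _ _ _ idS _ (sec N (ss_val x)) 1 ler01 Sx.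
    by move=> n; rewrite mul1r asum_sec asum_homo// geq_minl.
  by move=> _ /le_trans; apply; rewrite mul1r.
rewrite /= in_itv/= -ler_norml.
have : cabs (ss_val x n) <= n.+1%:R.
  by apply: le_trans (cabs_coord idS n Sx) _; rewrite ler_piMr.
by case: b; apply: le_trans; rewrite /f/= ?Re_le_cabs ?Im_le_cabs.
Qed.

(** The image of the unit ball lies in the continuous image of a coordinatewise compact set. *)
Lemma cesaro_op_compact : compact_operator (cesaro_op t (S := S)).
Proof.
split; first exact: cesaro_op_bounded.
apply: (@precompact_subset _ _ (cesaro_of_coord @` (coord_box `&` coord_ball))).
  move=> _ [x /= x1 <-]; have [f fK fx] := coord_ball_contains x1.
  exists f => //; apply: val_inj.
  suff : ss_val (cesaro_of_coord f) = ss_val (cesaro_op t x) by [].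
  by rewrite cesaro_of_coordE ?cesaro_opE ?fx//; case: fK.
apply: compact_precompact; first exact: norm_hausdorff.
apply: continuous_compact coord_ball_compact.
exact: cesaro_of_coord_continuous.
Qed.

End compactness.

(** * Hardy's inequality *)

Section hardy.
Variables (R : realType) (p : R) (p_gt1 : 1 < p).

Let p_gt0 : 0 < p. Proof. exact: lt_trans p_gt1. Qed.

(** Young's inequality for $a^{p-1}$ and $c$ with exponents $p/(p-1)$ and $p$, multiplied by $p$. *)
Lemma powR_young (a c : R) : 0 <= a -> 0 <= c ->
  p * (a `^ (p - 1) * c) <= (p - 1) * a `^ p + c `^ p.
Proof.
move=> a0 c0; have p1 : 0 < p - 1 by rewrite subr_gt0.
have q0 : 0 < p / (p - 1) by rewrite divr_gt0.
have pq : (p / (p - 1))^-1 + p^-1 = 1.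
  by rewrite invf_div -[X in _ + X]div1r -mulrDl subrK divff// gt_eqF.
have := conjugate_powR (powR_ge0 a (p - 1)) c0 q0 p_gt0 pq.
rewrite -powRrM mulrCA divff ?gt_eqF// mulr1 invf_div => h.
rewrite -[leRHS](mulfVK (lt0r_neq0 p_gt0)) mulrC ler_wpM2r ?(ltW p_gt0)//.
by apply: le_trans h _; rewrite [leRHS]mulrDl lerD2r [leLHS]mulrC mulrAC.
Qed.

(** Indexed by the number of terms, so that $b_N=(N+1)A_{N+1}-NA_N$ holds also for $N=0$. *)
Definition avg (b : nat -> R) n : R := n%:R^-1 * \sum_(0 <= k < n) b k.

Lemma avg_ge0 b n : (forall n, 0 <= b n) -> 0 <= avg b n.
Proof. by move=> b0; rewrite mulr_ge0 ?invr_ge0// sumr_ge0. Qed.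

(* Elliott's telescoping proof of Hardy's inequality, for partial sums *)
Lemma hardy_telescope (b : nat -> R) N : (forall n, 0 <= b n) ->
  (p - 1) * (\sum_(0 <= n < N) avg b n.+1 `^ p) + N%:R * avg b N `^ p <=
  p * \sum_(0 <= n < N) avg b n.+1 `^ (p - 1) * b n.
Proof.
move=> b0; have A0 n : 0 <= avg b n by exact: avg_ge0.
pose A := avg b; rewrite -/A in A0 *.
elim: N => [|N IH]; first by rewrite !big_geq// !mulr0 mul0r addr0.
rewrite !big_nat_recr//=.
have bN : b N = N.+1%:R * A N.+1 - N%:R * A N.
  have NA n : n%:R * A n = \sum_(0 <= k < n) b k.
    case: n => [|n]; first by rewrite mul0r big_geq.
    by rewrite mulVKf// pnatr_eq0.
  by rewrite !NA big_nat_recr//= addrAC subrr add0r.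
have aa : A N.+1 `^ (p - 1) * A N.+1 = A N.+1 `^ p by rewrite mulrC mulr_powRB1.
(* Young's inequality for two consecutive means turns the mixed term $A_{N+1}^{p-1}A_N$ into
   telescoping ones. *)
have := ler_wpM2l (ler0n R N) (powR_young (A0 N.+1) (A0 N)).
have -> : A N.+1 `^ (p - 1) * b N =
    N.+1%:R * A N.+1 `^ p - N%:R * (A N.+1 `^ (p - 1) * A N).
  by rewrite bN -aa; ring.
move: IH; rewrite -[N.+1%:R]natr1.
set S1 := \sum_(_ <= _ < _) _; set S2 := \sum_(_ <= _ < _) _.
set X := A N.+1 `^ p; set Y := A N `^ p; set Z := _ * A N.
set n := N%:R; move=> h1 h2.
have -> : (p - 1) * (S1 + X) + (n + 1) * X = (p - 1) * S1 + n * X + p * X by ring.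
have -> : p * (S2 + ((n + 1) * X - n * Z)) =
    p * S2 + p * X + (p * (n * X) - n * (p * Z)) by ring.
have : n * (p * Z) <= p * (n * X) - n * X + n * Y.
  by apply: le_trans h2 _; rewrite le_eqVlt; apply/orP; left; apply/eqP; ring.
lra.
Qed.

(** Young's inequality with $c=\frac{p}{p-1}b_n$ takes the place of Hölder's: it bounds $p$ times
    the left side by $p-1$ times it plus the right side. *)
Lemma hardy (b : nat -> R) N : (forall n, 0 <= b n) ->
  \sum_(0 <= n < N) (n.+1%:R^-1 * \sum_(0 <= k < n.+1) b k) `^ p <=
  \sum_(0 <= n < N) (p / (p - 1) * b n) `^ p.
Proof.
move=> b0; have p1 : 0 < p - 1 by rewrite subr_gt0.
have A0 n : 0 <= avg b n by exact: avg_ge0.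
pose A := avg b; rewrite -/A in A0.
rewrite -[leLHS]/(\sum_(0 <= n < N) A n.+1 `^ p).
have := hardy_telescope N b0; rewrite -/(A _) => H.
have {}H : (p - 1) * \sum_(0 <= n < N) A n.+1 `^ p <=
    p * \sum_(0 <= n < N) A n.+1 `^ (p - 1) * b n.
  by apply: le_trans H; rewrite lerDl mulr_ge0 ?powR_ge0.
have Y : \sum_(0 <= n < N) p * (A n.+1 `^ (p - 1) * (p / (p - 1) * b n)) <=
    (p - 1) * (\sum_(0 <= n < N) A n.+1 `^ p) +
    \sum_(0 <= n < N) (p / (p - 1) * b n) `^ p.
  rewrite mulr_sumr -big_split/=; apply: ler_sum => n _.
  by apply: powR_young => //; rewrite mulr_ge0// divr_ge0// ltW.
have E : \sum_(0 <= n < N) p * (A n.+1 `^ (p - 1) * (p / (p - 1) * b n)) =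
    p / (p - 1) * (p * \sum_(0 <= n < N) A n.+1 `^ (p - 1) * b n).
  rewrite !mulr_sumr; apply: eq_bigr => n _.
  by rewrite [_ * (_ * b n)]mulrCA [LHS]mulrCA.
rewrite E in Y; have {E} := ler_wpM2l (ltW (divr_gt0 p_gt0 p1)) H.
rewrite mulrA divfK ?gt_eqF// => /le_trans/(_ Y).
by set S1 := \sum_(_ <= _ < _) _; set S2 := \sum_(_ <= _ < _) _; lra.
Qed.

End hardy.

(** * The three spaces *)

Section cesaro_infty.
Variables (R : realType) (t : R) (t_ge0 : 0 <= t) (t_lt1 : t < 1).
Implicit Types (x y : nat -> R[i]).
Local Notation C := (gen_cesaro t).

Lemma ces_infty_le x (M : R) : (forall n, cesaro_abs x n <= M) ->
  ces_inftymem x /\ fine (ces_inftynorm x) <= M.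
Proof.
move=> xM; have xle : (ces_inftynorm x <= M%:E)%E.
  by apply: ge_ereal_sup => _ [n _ <-]; rewrite lee_fin.
have xfin : ces_inftymem x by apply: le_lt_trans xle _; exact: ltry.
by split=> //; rewrite -lee_fin fineK// ces_inftymem_fin.
Qed.

Lemma ces_infty_coord x n : ces_inftymem x -> cesaro_abs x n <= fine (ces_inftynorm x).
Proof. by move=> Sx; rewrite -lee_fin fineK ?ces_inftymem_fin// ces_inftynorm_ge. Qed.

Lemma ces_infty_solid x y (M : R) : 0 <= M -> ces_inftymem x ->
  (forall n, cesaro_abs y n <= M * cesaro_abs x n) ->
  ces_inftymem y /\ fine (ces_inftynorm y) <= M * fine (ces_inftynorm x).
Proof.
move=> M0 Sx yx; apply: ces_infty_le => n; apply: le_trans (yx n) _.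
by rewrite ler_wpM2l// ces_infty_coord.
Qed.

Lemma cesaro_abs_sec x n : cesaro_abs (sec n.+1 x) n = cesaro_abs x n.
Proof.
by rewrite /cesaro_abs -!/(asum _ _) asum_sec minnn.
Qed.

Lemma ces_infty_unit0 : ces_inftymem (unit_seq R 0).
Proof.
have [] // := @ces_infty_le (unit_seq R 0) 1.
by move=> n; rewrite cesaro_abs_unit0 invf_le1// ler1n.
Qed.

Lemma ces_infty_sec_coord x n (M : R) :
  (forall N, fine (ces_inftynorm (sec N x)) <= M) -> cesaro_abs x n <= M.
Proof.
move=> xM; rewrite -cesaro_abs_sec; apply: le_trans (xM n.+1).
apply: ces_infty_coord.
have [] // := ces_infty_solid (asum_ge0 x n.+1) ces_infty_unit0 (y := sec n.+1 x).
exact/cesaro_abs_leM/asum_sec_le.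
Qed.

Lemma gen_cesaro_abs_le x n : cesaro_abs (C x) n <= (1 - t)^-1 * cesaro_abs x n.
Proof. exact/cesaro_abs_leM/asum_gen_cesaro. Qed.

Let t1V : 0 <= (1 - t)^-1. Proof. by rewrite invr_ge0 subr_ge0 ltW. Qed.

Lemma ces_infty_ideal : ideal_space t (ces_infty_space R).
Proof.
split => /=.
- exact: ces_infty_solid.
- exact: ces_infty_coord.
- exact: ces_infty_unit0.
- move=> x M Sx xM.
  by have [] // := @ces_infty_le x M; move=> n; exact: ces_infty_sec_coord.
- move=> x M xM; have [Sx _] := ces_infty_le (fun n => ces_infty_sec_coord n xM).
  by have [] := ces_infty_solid t1V Sx (gen_cesaro_abs_le x).
Qed.

Lemma cvg0_dominated x y (M : R) :
  (forall n, cesaro_abs y n <= M * cesaro_abs x n) ->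
  cesaro_abs x n @[n --> \oo] --> (0 : R) -> cesaro_abs y n @[n --> \oo] --> (0 : R).
Proof.
move=> yx x0; apply: (@squeeze_cvgr _ _ _ _ (cst 0) (fun n => M * cesaro_abs x n)).
- by apply: nearW => n; rewrite cesaro_abs_ge0 yx.
- exact: cvg_cst.
- by rewrite -[X in _ --> X](mulr0 M); apply: cvgMl_tmp.
Qed.

Lemma ces_0_unit0 : ces_0mem (unit_seq R 0).
Proof.
split; first exact: ces_infty_unit0.
rewrite (_ : (fun n => cesaro_abs _ n) = harmonic); first exact: cvg_harmonic.
by apply/funext => n; rewrite cesaro_abs_unit0.
Qed.

(** The tail of [C x] has uniformly small means, and those of a finite section are $O(1/n)$. Bounded
    means of [x] thus suffice for [C x] to lie in [ces_0]. *)
Lemma gen_cesaro_cvg0 x (M : R) : (forall n, cesaro_abs x n <= M) ->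
  cesaro_abs (C x) n @[n --> \oo] --> (0 : R).
Proof.
move=> xM; have M0 : 0 <= M by exact: le_trans (cesaro_abs_ge0 x 0) (xM 0%N).
apply/cvgrPdist_lt => e e0.
pose N := Num.truncn (2 * (M / (1 - t)) / e).
have tailN n : cesaro_abs (tail N (C x)) n <= e / 2.
  apply: le_trans (cesaro_abs_leM (asum_gen_cesaro_tail t_ge0 t_lt1 N x) n) _.
  apply: le_trans (ler_wpM2l _ (xM n)) _; first by rewrite mulr_ge0.
  rewrite -mulrA ler_pdivrMl// [_^-1 * M]mulrC.
  have : 2 * (M / (1 - t)) / e < N.+1%:R := truncnS_gt _.
  rewrite ltr_pdivrMr// => h; lra.
have secN : cesaro_abs (sec N (C x)) n @[n --> \oo] --> (0 : R).
  apply: (cvg0_dominated (M := asum (C x) N) _ ces_0_unit0.2).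
  exact/cesaro_abs_leM/asum_sec_le.
have e2 : 0 < e / 2 by rewrite divr_gt0.
move/cvgrPdist_lt : secN => /(_ _ e2); apply: filterS => n.
rewrite !sub0r !normrN !ger0_norm ?cesaro_abs_ge0// => h.
rewrite {1}(sec_tail N (C x)) (splitr e); apply: le_lt_trans (cesaro_absD _ _ _) _.
exact: ltr_leD.
Qed.

Lemma ces_0_ideal : ideal_space t (ces_0_space R).
Proof.
split => /=.
- move=> x y M M0 [Sx x0] yx; have [Sy yle] := ces_infty_solid M0 Sx yx.
  by split=> //; split=> //; exact: cvg0_dominated yx x0.
- by move=> x n [Sx _]; exact: ces_infty_coord.
- exact: ces_0_unit0.
- move=> x M _ xM.
  by have [] // := @ces_infty_le x M; move=> n; exact: ces_infty_sec_coord.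
- move=> x M xM; have xle n := ces_infty_sec_coord n xM.
  have [Sx _] := ces_infty_le xle; split; last exact: gen_cesaro_cvg0 xle.
  by have [] := ces_infty_solid t1V Sx (gen_cesaro_abs_le x).
Qed.

(** Each entry of [C x] is at most a Cesàro mean of $|x|$, hence at most the norm, and averaging
    keeps this bound. *)
Lemma ces_infty_gen_cesaro_le x : ces_inftymem x ->
  fine (ces_inftynorm (C x)) <= fine (ces_inftynorm x).
Proof.
move=> Sx; apply: (ces_infty_le _).2 => n; rewrite /cesaro_abs ler_pdivrMl// mulr_natl.
rewrite -[n.+1 in leRHS]subn0 -sumr_const_nat; apply: ler_sum => k _.
apply: le_trans (cabs_gen_cesaro_le t_ge0 t_lt1 _ _) _.
exact: ces_infty_coord.
Qed.

End cesaro_infty.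

(** * The spaces [ces_p] for $1<p<\infty$ *)

Section cesaro_p.
Variables (R : realType) (t : R) (t_ge0 : 0 <= t) (t_lt1 : t < 1).
Variables (p : R) (p_gt1 : 1 < p).
Implicit Types (x y : nat -> R[i]).
Local Notation C := (gen_cesaro t).

Let p_gt0 : 0 < p. Proof. exact: lt_trans p_gt1. Qed.

Lemma ces_p_le x (M : R) : 0 <= M ->
  (forall N, \sum_(0 <= n < N) cesaro_abs x n `^ p <= M `^ p) ->
  ces_pmem p x /\ fine (ces_pnorm p x) <= M.
Proof.
move=> M0 xM.
have sle : (\sum_(0 <= n <oo) (cesaro_abs x n `^ p)%:E <= (M `^ p)%:E)%E.
  apply: lime_le; first by apply: is_cvg_nneseries => n _ _; rewrite lee_fin powR_ge0.
  by apply: nearW => N; rewrite sumEFin lee_fin.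
have xle : (ces_pnorm p x <= M%:E)%E.
  have -> : M%:E = ((M `^ p)%:E `^ p^-1)%E.
    by rewrite poweR_EFin -powRrM mulfV ?gt_eqF// powRr1.
  apply: gt0_ler_poweR; rewrite ?invr_ge0 ?(ltW p_gt0)//.
    by rewrite in_itv/= leey nneseries_ge0// => n _ _; rewrite lee_fin powR_ge0.
  by rewrite in_itv/= leey lee_fin powR_ge0.
have xfin : ces_pmem p x by apply: le_lt_trans xle _; exact: ltry.
by split=> //; rewrite -lee_fin fineK// ces_pmem_fin.
Qed.

Lemma ces_p_partial x N : ces_pmem p x ->
  \sum_(0 <= n < N) cesaro_abs x n `^ p <= fine (ces_pnorm p x) `^ p.
Proof.
move=> Sx; rewrite -lee_fin -poweR_EFin fineK ?ces_pmem_fin//.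
rewrite /ces_pnorm -poweRrM mulVf ?gt_eqF// poweRe1; last first.
  by apply: nneseries_ge0 => n _ _; rewrite lee_fin powR_ge0.
rewrite -sumEFin; apply: (nneseries_lim_ge (P := xpredT)) => n _ _.
by rewrite lee_fin powR_ge0.
Qed.

Lemma ces_p_norm_ge0 x : 0 <= fine (ces_pnorm p x).
Proof. exact/fine_ge0/ces_pnorm_ge0. Qed.

Lemma ces_p_coord x n : ces_pmem p x -> cesaro_abs x n <= fine (ces_pnorm p x).
Proof.
move=> Sx; rewrite leNgt; apply/negP => xn.
have := ces_p_partial n.+1 Sx; rewrite leNgt => /negP; apply.
rewrite big_nat_recr//=; apply: ltr_wpDl; first by rewrite sumr_ge0// => k _; rewrite powR_ge0.
by rewrite gt0_ltr_powR ?nnegrE ?cesaro_abs_ge0 ?ces_p_norm_ge0.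
Qed.

Lemma ces_p_solid x y (M : R) : 0 <= M -> ces_pmem p x ->
  (forall n, cesaro_abs y n <= M * cesaro_abs x n) ->
  ces_pmem p y /\ fine (ces_pnorm p y) <= M * fine (ces_pnorm p x).
Proof.
move=> M0 Sx yx; apply: ces_p_le => [|N]; first by rewrite mulr_ge0 ?ces_p_norm_ge0.
apply: (@le_trans _ _ (M `^ p * \sum_(0 <= n < N) cesaro_abs x n `^ p)).
  rewrite mulr_sumr; apply: ler_sum => n _.
  rewrite -powRM ?cesaro_abs_ge0//; apply: ge0_ler_powR; rewrite ?(ltW p_gt0)//.
    by rewrite nnegrE cesaro_abs_ge0.
  by rewrite nnegrE mulr_ge0 ?cesaro_abs_ge0.
by rewrite powRM ?ces_p_norm_ge0// ler_wpM2l ?powR_ge0// ces_p_partial.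
Qed.

(** Hardy's inequality is applied to the sequence of means [cesaro_abs x], whose own means dominate
    those of [y]. *)
Lemma ces_p_hardy x y : ces_pmem p x -> (forall m, cabs (y m) <= cesaro_abs x m) ->
  ces_pmem p y /\ fine (ces_pnorm p y) <= p / (p - 1) * fine (ces_pnorm p x).
Proof.
move=> Sx yx; have q0 : 0 <= p / (p - 1) by rewrite divr_ge0 ?subr_ge0 ?ltW.
apply: ces_p_le => [|N]; first by rewrite mulr_ge0 ?ces_p_norm_ge0.
apply: (@le_trans _ _ (\sum_(0 <= n < N) (p / (p - 1) * cesaro_abs x n) `^ p)).
  apply: le_trans (hardy p_gt1 N (cesaro_abs_ge0 x)); apply: ler_sum => n _.
  apply: ge0_ler_powR; rewrite ?nnegrE ?cesaro_abs_ge0 ?(ltW p_gt0)//.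
    by rewrite mulr_ge0 ?sumr_ge0// => k _; exact: cesaro_abs_ge0.
  by rewrite ler_wpM2l//; apply: ler_sum => k _; exact: yx.
rewrite powRM ?ces_p_norm_ge0//.
under eq_bigr do rewrite powRM ?cesaro_abs_ge0//.
by rewrite -mulr_sumr ler_wpM2l ?powR_ge0// ces_p_partial.
Qed.

(** The means are $1/(n+1)$, and the convergence of $\sum (n+1)^{-p}$ is read off Hardy's inequality
    for $(1,0,0,\dots)$. *)
Lemma ces_p_unit0 : ces_pmem p (unit_seq R 0).
Proof.
pose b n : R := (n == 0)%N%:R.
have bS n : \sum_(0 <= k < n.+1) b k = 1.
  by rewrite big_nat_recl//= big1 ?addr0.
pose q := p / (p - 1).
have q0 : 0 <= q by rewrite divr_ge0 ?subr_ge0 ?ltW.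
have [] // := @ces_p_le (unit_seq R 0) q q0 _ => N.
have := hardy p_gt1 N (fun n => ler0n R (n == 0)).
under eq_bigr do rewrite bS mulr1 -cesaro_abs_unit0.
move=> /le_trans; apply; case: N => [|N]; first by rewrite big_geq// powR_ge0.
rewrite big_nat_recl//= mulr1 big1 ?addr0// => n _.
by rewrite mulr0 powR0// gt_eqF.
Qed.

Lemma ces_p_sec_partial x (M : R) N : (forall N, fine (ces_pnorm p (sec N x)) <= M) ->
  \sum_(0 <= n < N) cesaro_abs x n `^ p <= M `^ p.
Proof.
move=> xM; have M0 : 0 <= M by exact: le_trans (ces_p_norm_ge0 _) (xM 0%N).
have Sx : ces_pmem p (sec N x).
  have [] // := ces_p_solid (asum_ge0 x N) ces_p_unit0 (y := sec N x).
  exact/cesaro_abs_leM/asum_sec_le.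
apply: (@le_trans _ _ (fine (ces_pnorm p (sec N x)) `^ p)); last first.
  by rewrite ge0_ler_powR ?nnegrE ?ces_p_norm_ge0 ?(ltW p_gt0).
apply: le_trans (ces_p_partial N Sx); rewrite le_eqVlt; apply/orP; left; apply/eqP.
apply: eq_big_nat => n /andP[_ nN].
by rewrite /cesaro_abs -!/(asum _ _) asum_sec (minn_idPl _).
Qed.

Lemma ces_p_ideal : ideal_space t (ces_p_space p_gt1).
Proof.
have secM x (M : R) : (forall N, fine (ces_pnorm p (sec N x)) <= M) ->
    ces_pmem p x /\ fine (ces_pnorm p x) <= M.
  move=> xM; apply: ces_p_le => [|N]; last exact: ces_p_sec_partial.
  exact: le_trans (ces_p_norm_ge0 _) (xM 0%N).
split => /=.
- exact: ces_p_solid.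
- exact: ces_p_coord.
- exact: ces_p_unit0.
- by move=> x M _ /secM[].
- move=> x M /secM[Sx _].
  have t1V : 0 <= (1 - t)^-1 by rewrite invr_ge0 subr_ge0 ltW.
  by have [] := ces_p_solid t1V Sx (gen_cesaro_abs_le t_ge0 t_lt1 x).
Qed.

End cesaro_p.

(** * Operator norm 1 on spaces carrying the supremum norm *)

Section infty_opnorm.
Variables (R : realType) (t : R) (t_ge0 : 0 <= t) (t_lt1 : t < 1).
Variables (S : seqspace R) (idS : ideal_space t S).
Hypothesis S_infty : forall x, ss_mem S x ->
  ces_inftymem x /\ ss_norm S x = fine (ces_inftynorm x).

Lemma cesaro_op_opnorm1 : opnorm (cesaro_op t (S := S)) = 1%E.
Proof.
apply/eqP; rewrite eq_le; apply/andP; split.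
  apply: opnorm_le => // x; rewrite mul1r !rnormE.
  have [_ ->] := S_infty (ss_memP (cesaro_op t x)); have [Sx ->] := S_infty (ss_memP x).
  by rewrite cesaro_opE// ces_infty_gen_cesaro_le.
(* The norm is attained at [unit_seq 0], whose zeroth entry 1 is preserved. *)
pose e : ss_type S := SSType (mem_set (ideal_unit0 idS) : _ \in ss_pred S).
apply: (@le_trans _ _ (rnorm (cesaro_op t e))%:E).
  have := ideal_coord idS 0 (ss_memP (cesaro_op t e)); rewrite lee_fin.
  apply: le_trans; rewrite cesaro_opE// /cesaro_abs invr1 mul1r big_nat1 gen_cesaro_at0.
  by rewrite [ss_val e 0](_ : _ = 1) ?cabs1.
apply: ereal_sup_ubound; exists e => //=; rewrite rnormE.
have [_ ->] := S_infty (ss_memP e); apply: (ces_infty_le _).2 => n /=.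
by rewrite cesaro_abs_unit0 invf_le1// ler1n.
Qed.

End infty_opnorm.

Theorem proposition8p2 (R : realType) (t : R) (t_ge0 : 0 <= t) (t_lt1 : t < 1) :
  (forall (p : R) (p_gt1 : 1 < p), exists T : ces_p p_gt1 -> ces_p p_gt1,
    [/\ acts_as_gen_cesaro t T,
        bounded_operator T &
        (opnorm T <= (Num.min (1 - t)^-1 (p / (p - 1)))%:E)%E] /\
    [/\ compact_operator T,
        point_spectrum T = Lambda R &
        spectrum T = Lambda0 R] /\
    [/\ power_bounded T,
        uniformly_mean_ergodic T &
        ~ supercyclic T]) /\
  (exists T : ces_0 R -> ces_0 R,
    [/\ acts_as_gen_cesaro t T,
        bounded_operator T,
        opnorm T = 1%E &
        power_bounded T] /\
    [/\ compact_operator T,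
        point_spectrum T = Lambda R &
        spectrum T = Lambda0 R] /\
    [/\ uniformly_mean_ergodic T &
        ~ supercyclic T]) /\
  (exists T : ces_infty R -> ces_infty R,
    [/\ acts_as_gen_cesaro t T,
        bounded_operator T,
        opnorm T = 1%E &
        power_bounded T] /\
    [/\ compact_operator T,
        point_spectrum T = Lambda R &
        spectrum T = Lambda0 R] /\
    [/\ uniformly_mean_ergodic T &
        ~ supercyclic T]).
Proof.
split=> [p p_gt1|].
  have idS := ces_p_ideal t_ge0 t_lt1 p_gt1.
  exists (@cesaro_op R t (ces_p_space p_gt1)); split; last first.
    split; split.
    - exact: cesaro_op_compact.
    - exact: cesaro_op_point_spectrum.
    - exact: cesaro_op_spectrum.
    - exact: cesaro_op_power_bounded.
    - exact: cesaro_op_ume.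
    - exact: cesaro_op_not_supercyclic.
  split; [exact: cesaro_opE|exact: cesaro_op_bounded|].
  (* Both bounds hold separately: $1/(1-t)$ by geometric convolution, $p/(p-1)$ by Hardy's
     inequality. *)
  rewrite /Num.min; case: ifP => _; apply: opnorm_le.
  - by rewrite invr_ge0 subr_ge0 ltW.
  - exact: cesaro_op_le.
  - by rewrite divr_ge0 ?subr_ge0 ?(ltW p_gt1)// (le_trans _ (ltW p_gt1)).
  - move=> x; rewrite !rnormE cesaro_opE//.
    have le_avg := cabs_gen_cesaro_le t_ge0 t_lt1 (ss_val x).
    by have [] := ces_p_hardy p_gt1 (ss_memP x) le_avg.
split.
  have idS := ces_0_ideal t_ge0 t_lt1.
  exists (@cesaro_op R t (ces_0_space R)); split; [split|split; split].
  - exact: cesaro_opE.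
  - exact: cesaro_op_bounded.
  - by apply: cesaro_op_opnorm1 => // x [].
  - exact: cesaro_op_power_bounded.
  - exact: cesaro_op_compact.
  - exact: cesaro_op_point_spectrum.
  - exact: cesaro_op_spectrum.
  - exact: cesaro_op_ume.
  - exact: cesaro_op_not_supercyclic.
have idS := ces_infty_ideal t_ge0 t_lt1.
exists (@cesaro_op R t (ces_infty_space R)); split; [split|split; split].
- exact: cesaro_opE.
- exact: cesaro_op_bounded.
- by apply: cesaro_op_opnorm1.
- exact: cesaro_op_power_bounded.
- exact: cesaro_op_compact.
- exact: cesaro_op_point_spectrum.
- exact: cesaro_op_spectrum.
- exact: cesaro_op_ume.
- exact: cesaro_op_not_supercyclic.
Qed.
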